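(* Let $\Omega\subset\mathbb{R}^n$ be an open convex set with finite inradius $\delta_0=\delta_0(\Omega)$. Let $m>0$, $\nu\in(0,1/m]$, $f\in C_0^1(\Omega)$ and $|\nabla f|/\delta\in L^1(\Omega)$. (i) If $\lambda\in\left[0,\frac{1+\nu m}{2}\right)$, then $$\frac{1-\nu^2m^2}{4}\int_\Omega\frac{|f(x)|}{\delta(x)^2}\,dx+\frac{c_\nu^2(m)}{\delta_0^m}\int_\Omega\frac{|f(x)|}{\delta(x)^{2-m}}\,dx\le\left(\frac{1+\nu m}{2}-\lambda^2\right)\int_\Omega\frac{|\nabla f(x)|}{\delta(x)}\,dx+\frac{\lambda^2-\lambda}{\delta_0}\int_\Omega|\nabla f(x)|\,dx.$$ (ii) If $\lambda\le 0$, then $$\frac{1-\nu^2m^2}{4}\int_\Omega\frac{|f(x)|}{\delta(x)^2}\,dx+\frac{c_\nu^2(m)}{\delta_0^m}\int_\Omega\frac{|f(x)|}{\delta(x)^{2-m}}\,dx\le\frac{1+\nu m}{2}\int_\Omega\frac{|\nabla f(x)|}{\delta(x)}\,dx-\frac{\lambda}{\delta_0}\int_\Omega|\nabla f(x)|\,dx.$$ Here $c_\nu(m)$ (which depends on $\lambda$) is the number satisfying $$(1-2\lambda)J_\nu\left(\tfrac{2}{m}c_\nu(m)\right)+2c_\nu(m)J_\nu'\left(\tfrac{2}{m}c_\nu(m)\right)=0\quad\text{and}\quad \tfrac{2}{m}c_\nu(m)\in(0,j_\nu).$$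
   Context: $J_\nu$ is the Bessel function of the first kind of order $\nu$, $J_\nu'$ its derivative, and $j_\nu$ the first positive zero of $J_\nu$; $c_\nu(m)$ is taken to be the first such root. For an open set $\Omega$, $\delta(x)=\operatorname{dist}(x,\partial\Omega)$ and the inradius is $\delta_0(\Omega)=\sup_{x\in\Omega}\delta(x)$. $C_0^1(\Omega)$ is the family of continuously differentiable functions $\Omega\to\mathbb{R}$ with compact support in $\Omega$. *)

(* Defs.v *)
(* MathComp-Analysis: everything is stated over an arbitrary [R : realType]. *)
From HB Require Import structures.
From mathcomp Require Import all_boot all_order all_algebra.
From mathcomp Require Import all_classical all_reals all_analysis.

Set Implicit Arguments.
Unset Strict Implicit.
Unset Printing Implicit Defensive.

Import Order.TTheory GRing.Theory Num.Theory.
Import numFieldNormedType.Exports.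

Local Open Scope classical_set_scope.
Local Open Scope ring_scope.

(* 'rV[R]_n carries the product sigma-algebra, generated by the coordinate
   projections, exactly as the library does for n.-tuple. *)
Definition measure_rV_display : measure_display -> measure_display.
Proof. exact. Qed.

Section measurable_rV.
Context {R : realType} (n : nat).

Definition rV_coord (i : 'I_n) (x : 'rV[R]_n) : measurableTypeR R := x 0 i.

Let rV_set0 : g_sigma_preimage rV_coord set0.
Proof. exact: sigma_algebra0. Qed.

Let rV_setC A : g_sigma_preimage rV_coord A -> g_sigma_preimage rV_coord (~` A).
Proof. exact: sigma_algebraC. Qed.

Let rV_bigcup (F : (set 'rV[R]_n)^nat) :
  (forall i, g_sigma_preimage rV_coord (F i)) ->
  g_sigma_preimage rV_coord (\bigcup_i (F i)).
Proof. exact: sigma_algebra_bigcup. Qed.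

HB.instance Definition _ := @isMeasurable.Build
  (measure_rV_display default_measure_display) 'rV[R]_n (g_sigma_preimage rV_coord) rV_set0 rV_setC rV_bigcup.

Lemma measurable_rV_coord (i : 'I_n) :
  measurable_fun [set: 'rV[R]_n] (rV_coord i).
Proof.
move=> _ Y mY; rewrite setTI; apply: sub_sigma_algebra => /=.
rewrite -bigcup_seq/=; exists i => /=; first by rewrite mem_index_enum.
by exists Y => //; rewrite setTI.
Qed.

Lemma measurable_fun_rV d (T : measurableType d) (f : T -> 'rV[R]_n) :
  (forall i, measurable_fun [set: T] (rV_coord i \o f)) ->
  measurable_fun [set: T] f.
Proof.
move=> mf.
suff : g_sigma_preimage (fun i => rV_coord i \o f) `<=` measurable.
  by rewrite g_sigma_preimage_comp => prefS _ A mA; apply: prefS; exists A.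
apply: smallest_sub; first exact: sigma_algebra_measurable.
rewrite -bigcup_seq; apply: bigcup_sub => i _.
by move=> A [B mB <-]; exact: mf.
Qed.

End measurable_rV.

Section rV_cons.
Context {R : realType} (n : nat).

Definition rV_cons (p : measurableTypeR R * 'rV[R]_n) : 'rV[R]_n.+1 :=
  \row_i oapp (p.2 0) p.1 (unlift ord0 i).

Lemma rV_cons0 p : rV_cons p 0 ord0 = p.1.
Proof. by rewrite mxE unlift_none. Qed.

Lemma rV_consS p (j : 'I_n) : rV_cons p 0 (lift ord0 j) = p.2 0 j.
Proof. by rewrite mxE liftK. Qed.

Lemma measurable_rV_cons : measurable_fun setT rV_cons.
Proof.
apply: measurable_fun_rV => i; case: (unliftP ord0 i) => [j|] ->.
  rewrite (_ : _ \o _ = rV_coord j \o snd); last first.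
    by apply/funext => p /=; rewrite /rV_coord rV_consS.
  by apply: measurableT_comp => //; exact: measurable_rV_coord.
rewrite (_ : _ \o _ = fst)//.
by apply/funext => p /=; rewrite /rV_coord rV_cons0.
Qed.

Variable mu : {sigma_finite_measure set 'rV[R]_n -> \bar R}.

Definition lebesgue_rV_step : set 'rV[R]_n.+1 -> \bar R :=
  pushforward (@lebesgue_measure R \x mu)%E rV_cons.

Let step0 : lebesgue_rV_step set0 = 0%E.
Proof. by rewrite /lebesgue_rV_step /pushforward preimage_set0 measure0. Qed.

Let step_ge0 A : (0 <= lebesgue_rV_step A)%E.
Proof. exact: (@measure_ge0 _ _ _ (@lebesgue_measure R \x mu)%E). Qed.

Let step_sigma_additive : semi_sigma_additive lebesgue_rV_step.
Proof.
move=> F mF tF mUF; rewrite /lebesgue_rV_step /pushforward preimage_bigcup.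
have mc A : measurable A -> measurable (rV_cons @^-1` A).
  by move=> mA; rewrite -[X in measurable X]setTI; exact: measurable_rV_cons.
apply: measure_semi_sigma_additive.
- by move=> k; exact: mc.
- apply/trivIsetP => /= i j _ _ ij; rewrite -preimage_setI.
  by move/trivIsetP : tF => /(_ _ _ _ _ ij) ->//; rewrite preimage_set0.
- by rewrite -preimage_bigcup; exact: mc.
Qed.

HB.instance Definition _ := isMeasure.Build _ _ _ lebesgue_rV_step
  step0 step_ge0 step_sigma_additive.

Let behead (x : 'rV[R]_n.+1) : 'rV[R]_n := \row_j x 0 (lift ord0 j).

Let step_sigma_finite : sigma_finite setT lebesgue_rV_step.
Proof.
have /sigma_finiteP[F [TF ndF Foo]] := sigma_finiteT (@lebesgue_measure R).
have /sigma_finiteP[G [TG ndG Goo]] := sigma_finiteT mu.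
have mb : measurable_fun setT behead.
  apply: measurable_fun_rV => j.
  rewrite (_ : _ \o _ = rV_coord (lift ord0 j)); last first.
    by apply/funext => x /=; rewrite /rV_coord mxE.
  exact: measurable_rV_coord.
have pE k : rV_cons @^-1` ((rV_coord ord0 @^-1` F k) `&` (behead @^-1` G k)) =
    F k `*` G k.
  apply/seteqP; split => -[a b] /=; rewrite /rV_coord rV_cons0 /=;
    by rewrite (_ : behead _ = b)//; apply/rowP => j; rewrite mxE rV_consS.
exists (fun k => (rV_coord ord0 @^-1` F k) `&` (behead @^-1` G k)).
  rewrite predeqE => x; split => // _.
  have : [set: measurableTypeR R] (rV_coord ord0 x) by [].
  rewrite TF => -[i _ Fi].
  have : [set: 'rV[R]_n] (behead x) by [].
  rewrite TG => -[j _ Gj].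
  have /subsetPset sF := ndF _ _ (leq_maxl i j).
  have /subsetPset sG := ndG _ _ (leq_maxr i j).
  by exists (maxn i j) => //; split; [exact: sF|exact: sG].
move=> k; have [? ?] := Foo k; have [? ?] := Goo k; split.
  apply: measurableI; rewrite -[X in measurable X]setTI.
    exact: measurable_rV_coord.
  exact: mb.
rewrite /lebesgue_rV_step /pushforward pE.
by rewrite product_measure1E// lte_mul_pinfty// ge0_fin_numE.
Qed.

HB.instance Definition _ := Measure_isSigmaFinite.Build _ _ _ lebesgue_rV_step
  step_sigma_finite.

End rV_cons.

Fixpoint lebesgue_rV_rec {R : realType} (n : nat) :
    {sigma_finite_measure set 'rV[R]_n -> \bar R} :=
  match n with
  | 0%N => @dirac _ 'rV[R]_0 0 R
  | k.+1 => lebesgue_rV_step (lebesgue_rV_rec k)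
  end.

(* n-dimensional Lebesgue measure (on Borel sets). *)
Definition lebesgue_rV {R : realType} {n : nat} : set 'rV[R]_n -> \bar R :=
  @lebesgue_rV_rec R n.

HB.instance Definition _ (R : realType) (n : nat) :=
  SigmaFiniteMeasure.on (@lebesgue_rV R n).

Lemma lebesgue_rV_box (R : realType) (n : nat)
    (A : 'I_n -> set (measurableTypeR R)) : (forall i, measurable (A i)) ->
  lebesgue_rV [set x : 'rV[R]_n | forall i, A i (x 0 i)] =
  (\prod_(i < n) lebesgue_measure (A i))%E.
Proof.
elim: n A => [|n IH] A mA.
  rewrite big_ord0 /lebesgue_rV /= diracE mem_set//.
  by case.
rewrite big_ord_recl -IH// /lebesgue_rV /= /lebesgue_rV_step /pushforward.
pose B := [set x : 'rV[R]_n | forall i, A (lift ord0 i) (x 0 i)].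
have mB : measurable B.
  rewrite (_ : B = \bigcap_i (rV_coord i @^-1` A (lift ord0 i))); last first.
    by apply/seteqP; split => x /= h i; [move=> _|]; exact: h.
  apply: fin_bigcap_measurable => // i _; rewrite -[X in measurable X]setTI.
  exact: measurable_rV_coord.
rewrite -[RHS]product_measure1E//; congr (product_measure1 _ _ _).
apply/seteqP; split => -[a b] /=.
  move=> h; split => /=; first by have := h ord0; rewrite rV_cons0.
  by move=> i; have := h (lift ord0 i); rewrite rV_consS.
move=> [ha hb] i; case: (unliftP ord0 i) => [j|] ->; rewrite ?rV_consS ?rV_cons0//.
Qed.

Section euclidean.
Context {R : realType} {n : nat}.
Implicit Types (x y : 'rV[R]_n) (A : set 'rV[R]_n) (f : 'rV[R]_n -> R).

(* The norm `|x| of the library on 'rV[R]_n is the sup norm. *)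
Definition enorm x : R := Num.sqrt (\sum_(i < n) x 0 i ^+ 2).

Definition boundary A : set 'rV[R]_n := closure A `\` interior A.

(* Extended-real valued, so that the distance to an empty boundary is +oo. *)
Definition dist_boundary A x : \bar R :=
  ereal_inf [set (enorm (x - y))%:E | y in boundary A].

Definition inradius A : \bar R := ereal_sup [set dist_boundary A x | x in A].

Definition gradient f x : 'rV[R]_n := \row_(i < n) 'D_(delta_mx 0 i) f x.

(* The values of f outside A are irrelevant. *)
Definition C1_compact_support A f : Prop :=
  [/\ forall x, A x -> differentiable f x,
      forall x, A x -> {for x, continuous (gradient f)},
      compact (closure (A `&` [set x | f x != 0])) &
      closure (A `&` [set x | f x != 0]) `<=` A].

End euclidean.

Section bessel.
Context {R : realType}.
Implicit Types (nu m lambda c s x : R).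

(* Only meaningful for 0 < s. *)
Definition Gamma s : R :=
  \int[@lebesgue_measure R]_(t in `]0, +oo[) (t `^ (s - 1) * expR (- t)).

(* Only meaningful for 0 < x and 0 <= nu. *)
Definition bessel_J nu x : R :=
  limn (series (fun k : nat =>
    (-1) ^+ k / (k`!%:R * Gamma (k%:R + nu + 1)) *
    (x / 2) `^ (2 * k%:R + nu))).

(* j_nu: for nu >= 0 the infimum is attained and positive, since J_nu is
   continuous and positive near 0+. *)
Definition bessel_zero nu : R := inf [set x | 0 < x /\ bessel_J nu x = 0].

Definition lamb_root nu m lambda c : Prop :=
  (1 - 2 * lambda) * bessel_J nu (2 / m * c)
    + 2 * c * derive1 (bessel_J nu) (2 / m * c) = 0
  /\ 0 < 2 / m * c < bessel_zero nu.

(* c_nu(m), a function of lambda as well, is the first of these roots. *)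
Definition is_lamb_constant nu m lambda c : Prop :=
  lamb_root nu m lambda c
  /\ forall c', lamb_root nu m lambda c' -> c <= c'.

End bessel.

(* Main.v *)
Require Import Defs.
From HB Require Import structures.
From mathcomp Require Import all_boot all_order all_algebra.
From mathcomp Require Import all_classical all_reals all_analysis.
From mathcomp Require Import measurable_realfun ring lra.

Set Implicit Arguments.
Unset Strict Implicit.
Unset Printing Implicit Defensive.

Import Order.TTheory GRing.Theory Num.Theory.
Import numFieldNormedType.Exports.

Local Open Scope classical_set_scope.
Local Open Scope ring_scope.

(** Write [d] for the distance to the complement of [Omega], which on [Omega]
    is the distance to the boundary, and suppose that [d <= delta0].

    The analytic core is an inequality for a one-variable profile [phi >= 0]
    with primitive [Psi] and a weight [w <= - phi']: the integral of
    [`|f| * w (d)] is at most that of [phi (d) * enorm (gradient f)]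
    ([hardy_potential]).  Since [Omega] is convex, [d] is concave and has slope
    one, so [Psi (d)] satisfies, weakly, that minus its Laplacian is at least
    [- phi' (d)]; testing this against [`|f|] and integrating by parts gives
    the inequality.  The proof replaces the Laplacian by second differences of
    step [h] along the axes:
    - at each point of [Omega] the hyperplane tangent to the largest inscribed
      ball at a touching point bounds [d] from above by an affine function
      with unit slope [e] ([cdist_supergradient]); hence the second differences
      of [Psi (d)] are of the right sign, and their sum is at least
      [h ^+ 2 * w (d)] up to a small error ([sum_second_difference]);
    - translation invariance of Lebesgue measure gives summation by parts
      ([summation_by_parts]), which leaves products of first differences of
      [`|f|] and of [Psi (d)];
    - a first difference of [Psi (d)] is [h * phi (d) * e 0 i] up to the second
      difference, and the integral of a second difference against a Lipschitz
      cutoff is [O(h ^+ 2)], again by summation by parts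
      ([cutoff_second_difference]).
    The Cauchy-Schwarz inequality and [h -> 0] finish this part.

    The profile comes from [y t = t `^ (1/2) * J_nu (2 / m * c * t `^ (m / 2))].
    Its logarithmic derivative [psi] solves
    [psi' = - (w + psi ^+ 2)] with
    [w t = (1 - nu^2 m^2) / 4 / t ^+ 2 + c ^+ 2 * t `^ (m - 2)], the equation
    that defines [c] says [psi 1 = lambda], and [t * psi t] decreases from
    [(1 + nu * m) / 2] at [0] to [lambda] at [1] ([lamb_profile]).  For (i) take
    [phi t = psi t - lambda + lambda ^+ 2 - lambda ^+ 2 / t] and for (ii)
    [phi t = psi t - lambda].  Both vanish at [1] and satisfy [phi' <= - w], the
    first because [0 <= lambda / t <= psi t]; and both lie below the weight on
    the right-hand side, because [t * psi t <= (1 + nu * m) / 2].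
    Rescaling to [0 < t < b] for [b > delta0] and letting [b] tend to [delta0]
    gives the theorem.

    The monotonicity of [t * psi t] is elementary once [J_nu] is written as
    [(x / 2) `^ nu / Gamma (nu + 1)] times an entire function of [x ^+ 2 / 4]
    ([bessel_JE]): it amounts to the positivity of a quadratic form in that
    function and its derivative, and a power of the variable times this form
    vanishes at [0] and has positive derivative ([riccati_energy_gt0]). *)

Lemma is_derive_continuous {R : realType} (f : R -> R) (x d : R) :
  is_derive x 1 f d -> {for x, continuous f}.
Proof.
move=> h; apply/differentiable_continuous/derivable1_diffP.
by apply: ex_derive.
Qed.

(** * Improper integrals of powers against exponentials, and Gamma *)

Section gamma.
Context {R : realType}.
Implicit Types s t : R.
Notation mu := (@lebesgue_measure R).

Definition gamma_integrand s t : R := t `^ (s - 1) * expR (- t).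

(** From [ln y < y] at [y = t / (2 * s)]; the constant is where the bound
    [s * ln y <= s * y = t / 2] leaves it. *)
Lemma powR_expR_le s t : 0 < s -> 0 <= t ->
  t `^ s * expR (- t) <= expR (s * ln (2 * s)) * expR (- (t / 2)).
Proof.
move=> s0; rewrite le_eqVlt => /predU1P[<-|t0].
  by rewrite powR0 ?gt_eqF// mul0r mulr_ge0// expR_ge0.
rewrite /powR gt_eqF// -!expRD ler_expR.
have -> : t = (2 * s) * (t / (2 * s)) by field; rewrite gt_eqF.
set y := t / (2 * s); have y0 : 0 < y by rewrite divr_gt0// mulr_gt0.
have s20 : 0 < 2 * s by rewrite mulr_gt0.
rewrite lnM ?posrE//; have := ln_sublinear y0 => ly.
suff : s * ln y <= s * y by lra.
by rewrite ler_pM2l// ltW.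
Qed.

Lemma continuous_powR_ge0 s t : 0 < s -> 0 <= t ->
  (fun x : R => x `^ s) @ within (fun x : R => 0 <= x) (nbhs t) --> t `^ s.
Proof.
move=> s0; rewrite le_eqVlt => /predU1P[<-|t0]; last first.
  apply: cvg_within_filter.
  exact: is_derive_continuous (is_derive1_powR _ t0).
rewrite powR0 ?gt_eqF//; apply/cvgrPdist_lt => e e0.
have /cvgrPdist_lt/(_ _ e0) := powR_cvg0 s0.
rewrite !near_withinE; apply: filterS => x h.
rewrite le_eqVlt => /predU1P[<-|/h//].
by rewrite powR0 ?gt_eqF// subrr normr0.
Qed.

Lemma within_continuous_gamma s : 1 < s ->
  {within `[0, +oo[, continuous (gamma_integrand s)}.
Proof.
move=> s1; apply/subspace_continuousP => t /=; rewrite in_itv/= andbT => t0.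
apply: cvgM.
  have := @continuous_powR_ge0 (s - 1) t; rewrite subr_gt0 => /(_ s1 t0).
  apply: cvg_trans; apply: cvg_app; apply: within_subset => x /=.
  by rewrite in_itv/= andbT.
apply: cvg_within_filter; apply: continuous_comp; first exact: continuousN.
exact: continuous_expR.
Qed.

(** The integrable majorant of the Gamma integrands. *)
Definition half_exp t : R := expR (- (t / 2)).

Lemma half_exp0 : half_exp 0 = 1.
Proof. by rewrite /half_exp mul0r oppr0 expR0. Qed.

Lemma half_exp_derive t : is_derive t 1 half_exp (- half_exp t / 2).
Proof.
by rewrite /half_exp; apply: is_derive_eq; rewrite /GRing.scale/=; field.
Qed.

Lemma half_exp_primitive t :
  is_derive t 1 (fun t => - 2 * half_exp t) (half_exp t).
Proof.
have dh := half_exp_derive t.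
by apply: is_derive_eq; rewrite /GRing.scale/=; field.
Qed.

Lemma half_exp_cvgy : half_exp t @[t --> +oo] --> 0.
Proof.
rewrite /half_exp.
apply: (@cvg_comp _ _ _ (fun z : R => z / 2) (fun z => expR (- z)) _
  (pinfty_nbhs R)); last exact: cvgr_expR.
by apply: gt0_cvgMly => //; rewrite invr_gt0.
Qed.

Lemma continuous_half_exp : continuous half_exp.
Proof.
by move=> t; exact: is_derive_continuous (half_exp_derive t).
Qed.

Lemma half_exp_integrable : mu.-integrable `[0, +oo[ (EFin \o half_exp).
Proof.
apply/integrableP; split.
  apply/measurable_EFinP; apply: measurable_funTS.
  exact: continuous_measurable_fun continuous_half_exp.
under eq_integral do rewrite /= ger0_norm ?expR_ge0//.
rewrite (@ge0_continuous_FTC2y _ _ (fun t => - 2 * half_exp t) _ 0).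
- by rewrite -EFinB ltry.
- by move=> x _; exact: expR_ge0.
- by apply: continuous_subspaceT; exact: continuous_half_exp.
- by rewrite -(mulr0 (-2)); apply: cvgM; [exact: cvg_cst|exact: half_exp_cvgy].
- by move=> x _; have [] := half_exp_primitive x.
- apply: cvgM; [exact: cvg_cst|apply/cvg_at_right_filter].
  exact: continuous_half_exp.
- by move=> x _; rewrite derive1E; have [] := half_exp_primitive x.
Qed.

Lemma half_exp_integrableZ c :
  mu.-integrable `[0, +oo[ (EFin \o (fun t => c * half_exp t)).
Proof. by have := @integrableZl _ _ _ mu _ _ c _ half_exp_integrable; exact. Qed.

Lemma gamma_integrable s : 1 < s ->
  mu.-integrable `[0, +oo[ (EFin \o gamma_integrand s).
Proof.
move=> s1.
set C := expR ((s - 1) * ln (2 * (s - 1))).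
apply: (@le_integrable _ _ _ mu _ _ _ (EFin \o (fun t => C * half_exp t))) => //.
- apply/measurable_EFinP; apply: subspace_continuous_measurable_fun => //.
  exact: within_continuous_gamma.
- move=> t /=; rewrite in_itv/= andbT => t0; rewrite lee_fin.
  rewrite ger0_norm ?mulr_ge0 ?powR_ge0 ?expR_ge0//.
  rewrite ger0_norm ?mulr_ge0 ?powR_ge0 ?expR_ge0//.
  by apply: powR_expR_le => //; rewrite subr_gt0.
- exact: half_exp_integrableZ.
Qed.

(** [t `^ s * expR (- t)] vanishes at both ends and its derivative is the
    difference of the two Gamma integrands.  That derivative changes sign, while
    the improper fundamental theorem is for nonnegative integrands, so a
    multiple of [half_exp] that dominates the negative part is added and its
    integral subtracted at the end. *)
Lemma GammaS s : 1 < s -> Gamma (s + 1) = s * Gamma s :> R.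
Proof.
move=> s1; have s0 : 0 < s by lra.
have i0 : mu.-integrable `[0, +oo[ (EFin \o gamma_integrand (s + 1)).
  by apply: gamma_integrable; lra.
have i1 := gamma_integrable s1.
set C := expR (s * ln (2 * s)).
have i2 := half_exp_integrableZ C.
have i3 : mu.-integrable `[0, +oo[ (EFin \o (fun t => s * gamma_integrand s t)).
  by have := @integrableZl _ _ _ mu _ _ s _ i1; exact.
have sub : `]0, +oo[%classic `<=` (`[0, +oo[%classic : set R).
  by apply: subset_itvr; rewrite bnd_simp.
have io f : mu.-integrable `[0, +oo[ (EFin \o f) ->
    mu.-integrable `]0, +oo[ (EFin \o f).
  by apply: integrableS.
rewrite /Gamma !Rintegral_itv_obnd_cbnd; [|exact: io..].
have E0 : \int[mu]_(t in `[0, +oo[) (C * half_exp t) = 2 * C.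
  rewrite RintegralZl//; last exact: half_exp_integrable.
  rewrite (@Rintegral_ge0_continuous_FTC2y _ _ (fun t => - 2 * half_exp t) _ 0).
  - by rewrite half_exp0; ring.
  - by move=> x _; exact: expR_ge0.
  - by apply: continuous_subspaceT; exact: continuous_half_exp.
  - by rewrite -(mulr0 (-2)); apply: cvgM; [exact: cvg_cst|exact: half_exp_cvgy].
  - by move=> x _; have [] := half_exp_primitive x.
  - apply: cvgM; [exact: cvg_cst|apply/cvg_at_right_filter].
    exact: continuous_half_exp.
  - by move=> x _; rewrite derive1E; have [] := half_exp_primitive x.
have E1 : \int[mu]_(t in `[0, +oo[)
   (s * gamma_integrand s t + C * half_exp t - gamma_integrand (s + 1) t) = 2 * C.
  pose F t := t `^ s * expR (- t) - 2 * C * half_exp t.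
  have F' t : 0 < t -> is_derive t 1 F
      (s * gamma_integrand s t + C * half_exp t - gamma_integrand (s + 1) t).
    move=> t0; rewrite /F /gamma_integrand addrK.
    have := half_exp_derive t => dh; have := is_derive1_powR s t0 => dp.
    by apply: is_derive_eq; rewrite /GRing.scale/=; field.
  rewrite (@Rintegral_ge0_continuous_FTC2y _ _ F _ 0).
  - by rewrite /F powR0 ?gt_eqF// half_exp0; ring.
  - move=> x x0; rewrite subr_ge0 /gamma_integrand addrK.
    apply: le_trans (powR_expR_le s0 x0) _; rewrite lerDr.
    by rewrite !mulr_ge0 ?powR_ge0 ?expR_ge0// ltW.
  - move=> t; apply: cvgB; first apply: cvgD.
    + apply: cvgM; first exact: cvg_cst.
      exact: (within_continuous_gamma s1).
    + apply: cvgM; first exact: cvg_cst.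
      exact: (continuous_subspaceT continuous_half_exp).
    + by apply: within_continuous_gamma; lra.
  - have CFy : C * half_exp t @[t --> +oo] --> 0.
      by rewrite -(mulr0 C); apply: cvgM; [exact: cvg_cst|exact: half_exp_cvgy].
    rewrite -(subr0 0); apply: cvgB.
      apply: (squeeze_cvgr _ (cvg_cst 0) CFy); near=> t.
      rewrite mulr_ge0 ?powR_ge0 ?expR_ge0//= powR_expR_le//.
    rewrite -(mulr0 2); under eq_fun do rewrite -mulrA.
    by apply: cvgM; [exact: cvg_cst|exact: CFy].
  - by move=> x x0; have [] := F' _ x0.
  - apply: cvgB; last first.
      apply: cvgM; first exact: cvg_cst.
      by apply/cvg_at_right_filter; exact: continuous_half_exp.
    apply: cvgM; first by rewrite powR0 ?gt_eqF//; exact: powR_cvg0.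
    apply/cvg_at_right_filter; apply: continuous_comp; first exact: continuousN.
    exact: continuous_expR.
  - move=> x; rewrite in_itv/= andbT => x0; rewrite derive1E.
    exact: (@derive_val _ _ _ _ _ _ _ (F' _ x0)).
move: E1; rewrite RintegralB//; last exact: (integrableD _ i3 i2).
rewrite RintegralD// E0 RintegralZl// /gamma_integrand; lra.
Unshelve. all: by end_near. Qed.
End gamma.

(** * The Bessel-Clifford function *)

Section bessel_series.
Context {R : realType}.
Implicit Types (nu z x : R) (k n : nat).

Definition pochhammer (a : R) k : R := \prod_(j < k) (a + j%:R).

Lemma pochhammer_recr a k : pochhammer a k.+1 = pochhammer a k * (a + k%:R).
Proof. by rewrite /pochhammer big_ord_recr. Qed.

Lemma pochhammer_recl a k : pochhammer a k.+1 = a * pochhammer (a + 1) k.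
Proof.
rewrite /pochhammer big_ord_recl addr0; congr (_ * _).
by apply: eq_bigr => i _; rewrite /bump/= natrD addrA.
Qed.

Lemma pochhammer_ge1 a k : 1 <= a -> 1 <= pochhammer a k.
Proof.
move=> a1; elim: k => [|k ih]; first by rewrite /pochhammer big_ord0.
rewrite pochhammer_recr; have : (0 : R) <= k%:R by []. nra.
Qed.

Lemma pochhammer_neq0 a k : 1 <= a -> pochhammer a k != 0.
Proof. by move=> a1; rewrite gt_eqF//; have := pochhammer_ge1 k a1; lra. Qed.

(** The series of [nu], normalised to be [1] at [0]; its terms in
    [x ^+ 2 / 4] are those of [J_nu] at [x] divided by
    [(x / 2) `^ nu / Gamma (nu + 1)]. *)
Definition clifford_coef nu k : R :=
  (-1) ^+ k / (k`!%:R * pochhammer (nu + 1) k).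

Definition clifford nu z : R := limn (pseries (clifford_coef nu) z).

Lemma fact_neq0 k : k`!%:R != 0 :> R.
Proof. by rewrite pnatr_eq0 -lt0n fact_gt0. Qed.

Lemma clifford_coef_diffs nu : 0 <= nu ->
  pseries_diffs (clifford_coef nu) =
  (fun k => - (nu + 1)^-1 * clifford_coef (nu + 1) k).
Proof.
move=> nu0; apply/funext => k; rewrite /pseries_diffs /clifford_coef.
rewrite pochhammer_recl factS natrM exprS.
have := fact_neq0 k; have : (k.+1%:R : R) != 0 by rewrite pnatr_eq0.
have : pochhammer (nu + 1 + 1) k != 0 by apply: pochhammer_neq0; lra.
have : nu + 1 != 0 by rewrite gt_eqF//; lra.
move: (k`!%:R) (k.+1%:R) (pochhammer _ _) => F K P h1 h2 h3 h4.
by field; rewrite h1 h2 h3 h4.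
Qed.

Lemma clifford_cvg nu z : 0 <= nu -> cvgn (pseries (clifford_coef nu) z).
Proof.
move=> nu0; apply: normed_cvg; rewrite /normed_series_of/=.
apply: (@series_le_cvg _ _ (exp_coeff `|z|)) => [k|k|k|].
- exact: normr_ge0.
- by rewrite /exp_coeff/= divr_ge0// exprn_ge0.
- rewrite /exp_coeff/= normrM normrX mulrC ler_wpM2l// ?exprn_ge0//.
  rewrite /clifford_coef normrM normrX normrN1 expr1n mul1r.
  have p1 : 1 <= pochhammer (nu + 1) k by apply: pochhammer_ge1; lra.
  have k0 : 0 < k`!%:R :> R by rewrite ltr0n fact_gt0.
  rewrite ger0_norm; last by rewrite invr_ge0 mulr_ge0//; lra.
  by rewrite lef_pV2 ?posrE ?mulr_gt0//; [rewrite ler_peMr// ltW|lra].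
- exact: is_cvg_series_exp_coeff.
Qed.

Lemma pseriesZ (c : R) (f : nat -> R) z :
  pseries (fun k => c * f k) z = (fun n => c * pseries f z n).
Proof.
apply/funext => n; rewrite /pseries /series /= mulr_sumr.
by apply: eq_bigr => i _; rewrite mulrA.
Qed.

(** Term by term, differentiating shifts the order: [k.+1] cancels in the
    factorial and the first factor [nu + 1] leaves the Pochhammer symbol. *)
Lemma clifford_derive nu z : 0 <= nu ->
  is_derive z 1 (clifford nu) (- (nu + 1)^-1 * clifford (nu + 1) z).
Proof.
move=> nu0; have nu1 : 0 <= nu + 1 by lra.
have cvgZ c f x : cvgn (pseries f x) -> cvgn (pseries (fun k => c * f k) x).
  by move=> h; rewrite pseriesZ; apply: (cvgP _ (cvgM (cvg_cst c) h)).
have dE := clifford_coef_diffs nu0.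
have -> : - (nu + 1)^-1 * clifford (nu + 1) z =
    limn (pseries (pseries_diffs (clifford_coef nu)) z).
  rewrite dE pseriesZ; apply/esym/cvg_lim => //.
  by apply: cvgM; [exact: cvg_cst|exact: clifford_cvg].
apply: (@pseries_snd_diffs _ _ (`|z| + 1)).
- exact: clifford_cvg.
- by rewrite dE; apply: cvgZ; exact: clifford_cvg.
- rewrite dE (_ : pseries_diffs _ = fun k => - (nu + 1)^-1 *
    pseries_diffs (clifford_coef (nu + 1)) k); last first.
    by apply/funext => k; rewrite /pseries_diffs mulrCA.
  rewrite clifford_coef_diffs//; have nu2 : 0 <= nu + 1 + 1 by lra.
  apply: (cvgZ _ (fun k => - (nu + 1 + 1)^-1 * clifford_coef (nu + 1 + 1) k)).
  by apply: (cvgZ _ (clifford_coef (nu + 1 + 1))); exact: clifford_cvg.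
- by rewrite [ltRHS]ger0_norm ?ltrDl// addr_ge0.
Qed.

(** By [clifford_derive] this relation between three consecutive orders is the
    differential equation [z u'' + (nu + 1) u' + u = 0]. *)
Lemma clifford_contiguous nu z : 0 <= nu ->
  clifford nu z - clifford (nu + 1) z
    + z / ((nu + 1) * (nu + 2)) * clifford (nu + 2) z = 0.
Proof.
move=> nu0.
pose S mu n := pseries (clifford_coef mu) z n.
(* The third sum is shifted by one because of the factor z. *)
have SE n : S nu n.+1 - S (nu + 1) n.+1
    + z / ((nu + 1) * (nu + 2)) * S (nu + 2) n = 0.
  elim: n => [|n ih].
    rewrite /S /pseries /series/= !big_nat1 big_geq// /clifford_coef.
    by rewrite /pochhammer !big_ord0; ring.
  have SS mu k : S mu k.+1 = S mu k + clifford_coef mu k * z ^+ k.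
    by rewrite /S /pseries /series/= big_nat_recr.
  rewrite (SS nu) (SS (nu + 1)) (SS (nu + 2)).
  suff : clifford_coef nu n.+1 - clifford_coef (nu + 1) n.+1
      + clifford_coef (nu + 2) n / ((nu + 1) * (nu + 2)) = 0.
    move=> h; rewrite -[RHS](mulr0 (z ^+ n.+1)) -h -[LHS]subr0 -ih exprS; ring.
  have h1 : nu + 1 != 0 by rewrite gt_eqF//; lra.
  have h2 : nu + 2 != 0 by rewrite gt_eqF//; lra.
  have h3 : nu + 2 + n%:R != 0.
    by rewrite gt_eqF//; have : (0 : R) <= n%:R by []; lra.
  have pE : pochhammer (nu + 2 + 1) n =
      pochhammer (nu + 2) n * (nu + 2 + n%:R) / (nu + 2).
    by rewrite -pochhammer_recr pochhammer_recl mulrAC mulfV// mul1r.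
  rewrite /clifford_coef (pochhammer_recl (nu + 1)).
  rewrite (_ : nu + 1 + 1 = nu + 2); last by ring.
  rewrite pE pochhammer_recr factS natrM exprS -natr1.
  have h4 := fact_neq0 n.
  have h5 : n%:R + 1 != 0 :> R by rewrite natr1 pnatr_eq0.
  have h6 : pochhammer (nu + 2) n != 0 by apply: pochhammer_neq0; lra.
  move: (n`!%:R) (n%:R) (pochhammer _ _) ((-1) ^+ n) h3 h4 h5 h6 => F N P e h3 h4 h5 h6.
  by field; rewrite h1 h2 h3 h4 h5 h6.
have cS mu : 0 <= mu -> S mu n @[n --> \oo] --> clifford mu z.
  by move=> mu0; exact: clifford_cvg.
have : (fun n => S nu n.+1 - S (nu + 1) n.+1
    + z / ((nu + 1) * (nu + 2)) * S (nu + 2) n) @ \oo -->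
   clifford nu z - clifford (nu + 1) z
    + z / ((nu + 1) * (nu + 2)) * clifford (nu + 2) z.
  apply: cvgD; last by apply: cvgM; [exact: cvg_cst|apply: cS; lra].
  by apply: cvgB; rewrite (cvg_shiftS (S _)); apply: cS; lra.
rewrite (_ : (fun n => _) = cst 0); last by apply/funext => n; exact: SE.
by move=> /cvg_lim <-//; rewrite lim_cst.
Qed.
End bessel_series.

(** * The Riccati equation of a logarithmic derivative *)

Section riccati.
Context {R : realType}.
Implicit Types x y z t : R.
Variables (nu z1 : R) (u u1 u2 : R -> R).
Hypothesis nu_gt0 : 0 < nu.
Hypothesis u_derive : forall z : R, is_derive z 1 u (u1 z).
Hypothesis u1_derive : forall z : R, is_derive z 1 u1 (u2 z).
Hypothesis u_ode : forall z : R, z * u2 z + (nu + 1) * u1 z + u z = 0.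
Hypothesis u_gt0 : forall z : R, 0 <= z < z1 -> 0 < u z.

(** The Euler derivative [z u' / u]. *)
Definition riccati z := z * u1 z / u z.

(** [u ^+ 2] times minus [z] times the derivative of [riccati]. *)
Let energy z := z ^+ 2 * u1 z ^+ 2 + nu * z * u z * u1 z + z * u z ^+ 2.

Let energy_gt0 z : 0 < z < z1 -> 0 < energy z.
Proof.
move=> /andP[z0 zz1].
(* The equation gives energy' = - (nu / z) * energy + u ^+ 2, so z `^ nu is an
   integrating factor. *)
pose G t := t `^ nu * energy t.
have dG t : 0 < t -> is_derive t 1 G (t `^ nu * u t ^+ 2).
  move=> t0; have := u_derive t; have := u1_derive t => d1 d0.
  have := is_derive1_powR nu t0 => dp.
  rewrite /G /energy; apply: is_derive_eq; rewrite /GRing.scale/=.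
  have -> : u2 t = - ((nu + 1) * u1 t + u t) / t.
    have := u_ode t => h; apply: (mulfI (lt0r_neq0 t0)).
    by rewrite mulrCA mulfV ?gt_eqF// mulr1; lra.
  rewrite powRB; last by rewrite (gt_eqF t0) implybT.
  rewrite powRr1 ?ltW//; field; rewrite ?gt_eqF//.
have cE : continuous energy.
  move=> t; have := is_derive_continuous (u_derive t).
  have := is_derive_continuous (u1_derive t) => c1 c0.
  rewrite /energy; apply: cvgD; first apply: cvgD.
  - by apply: cvgM; apply: cvgM => //; exact: cvg_id.
  - apply: cvgM => //; apply: cvgM => //; apply: cvgM; [exact: cvg_cst|exact: cvg_id].
  - by apply: cvgM; [exact: cvg_id|apply: cvgM].
have cG : {within `[0, z], continuous G}.
  apply/subspace_continuousP => t /=; rewrite in_itv/= => /andP[t0 tz].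
  apply: cvgM; last by apply: cvg_within_filter; exact: cE.
  apply: cvg_trans (continuous_powR_ge0 nu_gt0 t0).
  apply: cvg_app; apply: within_subset => x /=.
  by rewrite in_itv/= => /andP[].
have dG' t : t \in `]0, z[ -> is_derive t 1 G (t `^ nu * u t ^+ 2).
  by rewrite in_itv/= => /andP[? _]; exact: dG.
have [t] := MVT z0 dG' cG; rewrite in_itv/= => /andP[t0 tz].
rewrite {2}/G powR0 ?gt_eqF// mul0r !subr0 => GE.
have ut : 0 < u t by apply: u_gt0; rewrite ltW//= (lt_trans tz).
have : 0 < G z by rewrite GE !mulr_gt0// ?powR_gt0// exprn_gt0.
by rewrite /G pmulr_rgt0// powR_gt0.
Qed.

Lemma riccati_derive z : 0 < z < z1 ->
  is_derive z 1 riccati (- (nu * riccati z + z + riccati z ^+ 2) / z).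
Proof.
move=> /andP[z0 zz1]; have uz : 0 < u z by apply: u_gt0; rewrite ltW.
have := u_derive z; have := u1_derive z => d1 d0.
rewrite /riccati.
have uN0 : u z != 0 by rewrite gt_eqF.
have dV := is_deriveV uN0.
apply: is_derive_eq; rewrite /GRing.scale/=.
have -> : u2 z = - ((nu + 1) * u1 z + u z) / z.
  have := u_ode z => h; apply: (mulfI (lt0r_neq0 z0)).
  by rewrite mulrCA mulfV ?gt_eqF// mulr1; lra.
by field; rewrite uN0 gt_eqF.
Qed.

Lemma riccati_energy_gt0 z : 0 < z < z1 ->
  0 < nu * riccati z + z + riccati z ^+ 2.
Proof.
move=> zz; have uz : 0 < u z by apply: u_gt0; case/andP: zz => /ltW -> ->.
have -> : nu * riccati z + z + riccati z ^+ 2 = energy z / u z ^+ 2.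
  by rewrite /riccati /energy; field; rewrite gt_eqF.
by rewrite divr_gt0 ?energy_gt0// exprn_gt0.
Qed.

Lemma riccati_nincr x y : 0 <= x -> x <= y -> y < z1 -> riccati y <= riccati x.
Proof.
move=> x0 xy yz1.
have cr : {within `[x, y], continuous riccati}.
  apply/subspace_continuousP => t /=; rewrite in_itv/= => /andP[xt ty].
  apply: cvg_within_filter.
  have ut : 0 < u t.
    by apply: u_gt0; rewrite (le_trans x0 xt)/= (le_lt_trans ty).
  apply: cvgM; last apply: cvgV; rewrite ?gt_eqF//.
    by apply: cvgM; [exact: cvg_id|exact: is_derive_continuous (u1_derive t)].
  exact: is_derive_continuous (u_derive t).
have dr t : t \in `]x, y[ ->
    is_derive t 1 riccati (- (nu * riccati t + t + riccati t ^+ 2) / t).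
  rewrite in_itv/= => /andP[xt ty]; apply: riccati_derive.
  by rewrite (le_lt_trans x0 xt)/= (lt_trans ty).
have [/eqP ->//|xNy] := boolP (x == y).
have {}xy : x < y by rewrite lt_neqAle xNy.
have [t] := MVT xy dr cr; rewrite in_itv/= => /andP[xt ty] E.
rewrite -subr_le0 E mulr_le0_ge0// ?subr_ge0 1?ltW//.
have tz : 0 < t < z1 by rewrite (le_lt_trans x0 xt)/= (lt_trans ty).
rewrite nmulr_rlt0 ?oppr_lt0 ?riccati_energy_gt0// invr_gt0.
by case/andP: tz.
Qed.

End riccati.

(** * Bessel functions in terms of the Bessel-Clifford function *)

Section bessel_clifford.
Context {R : realType}.
Implicit Types nu x z m lambda c t : R.

Lemma Gamma_pochhammer nu k : 0 < nu ->
  Gamma (k%:R + nu + 1) = Gamma (nu + 1) * pochhammer (nu + 1) k.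
Proof.
move=> nu0; elim: k => [|k ih]; first by rewrite add0r /pochhammer big_ord0 mulr1.
rewrite pochhammer_recr mulrA -ih.
rewrite (_ : k.+1%:R + nu + 1 = k%:R + nu + 1 + 1); last by rewrite -natr1; ring.
rewrite GammaS; first by rewrite mulrC; congr (_ * _); ring.
by have : (0 : R) <= k%:R by []; lra.
Qed.

Definition bessel_scale nu : R := (Gamma (nu + 1))^-1.

Lemma bessel_JE nu x : 0 < nu -> 0 < x ->
  bessel_J nu x = bessel_scale nu * (x / 2) `^ nu * clifford nu (x ^+ 2 / 4).
Proof.
move=> nu0 x0; rewrite /bessel_J.
have -> : (fun k : nat => (-1) ^+ k / (k`!%:R * Gamma (k%:R + nu + 1)) *
    (x / 2) `^ (2 * k%:R + nu)) =
    (fun k => (bessel_scale nu * (x / 2) `^ nu) *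
      (clifford_coef nu k * (x ^+ 2 / 4) ^+ k)).
  apply/funext => k; rewrite Gamma_pochhammer// /bessel_scale /clifford_coef.
  have x20 : 0 < x / 2 by rewrite divr_gt0.
  rewrite powRD; last by rewrite (gt_eqF x20) implybT.
  have -> : (x / 2) `^ (2 * k%:R) = (x ^+ 2 / 4) ^+ k.
    rewrite -natrM powR_mulrn ?ltW// exprM; congr (_ ^+ k); field; done.
  rewrite !invfM; ring.
apply/cvg_lim => //.
have := @clifford_cvg _ _ (x ^+ 2 / 4) (ltW nu0).
move=> /(cvgM (cvg_cst (bessel_scale nu * (x / 2) `^ nu))).
apply: cvg_trans; apply: near_eq_cvg; apply: nearW => n.
by rewrite /pseries /series/= mulr_sumr.
Qed.

Lemma bessel_J_derive nu x : 0 < nu -> 0 < x ->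
  x * derive1 (bessel_J nu) x = bessel_scale nu * (x / 2) `^ nu *
   (nu * clifford nu (x ^+ 2 / 4)
     + 2 * (x ^+ 2 / 4) * (- (nu + 1)^-1 * clifford (nu + 1) (x ^+ 2 / 4))).
Proof.
move=> nu0 x0.
pose g y : R := bessel_scale nu * (y / 2) `^ nu * clifford nu (y ^+ 2 / 4).
rewrite derive1E (@near_eq_derive _ _ _ _ g); last first.
  by near=> y; rewrite bessel_JE//; near: y; exact: lt_nbhsr.
pose D : R := bessel_scale nu *
  ((nu * (x / 2) `^ (nu - 1) * 2^-1) * clifford nu (x ^+ 2 / 4)
  + (x / 2) `^ nu * ((- (nu + 1)^-1 * clifford (nu + 1) (x ^+ 2 / 4)) * (x / 2))).
have x20 : 0 < x / 2 by rewrite divr_gt0.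
have dg : is_derive x 1 g D.
  have d1 := is_derive1_powR nu x20.
  have d2 := @clifford_derive _ _ (x ^+ 2 / 4) (ltW nu0).
  rewrite /g.
  have e1 : is_derive x 1 (fun y : R => y / 2) (2^-1).
    by apply: is_derive_eq; rewrite /GRing.scale/=; field.
  have e2 : is_derive x 1 (fun y : R => y ^+ 2 / 4) (x / 2).
    by apply: is_derive_eq; rewrite /GRing.scale/=; field.
  have f1 : is_derive x 1 (fun y : R => (y / 2) `^ nu) (nu * (x / 2) `^ (nu - 1) * 2^-1).
    exact: (is_derive1_comp (f := @powR R ^~ nu) (g := fun y => y / 2) d1 e1).
  have f2 : is_derive x 1 (fun y : R => clifford nu (y ^+ 2 / 4))
      (- (nu + 1)^-1 * clifford (nu + 1) (x ^+ 2 / 4) * (x / 2)).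
    exact: (is_derive1_comp (f := clifford nu) (g := fun y => y ^+ 2 / 4) d2 e2).
  rewrite /D; apply: (is_derive_eq _ _).
  rewrite /GRing.scale/= ; ring.
rewrite (@derive_val _ _ _ _ _ _ _ dg) /D.
rewrite powRB; last by rewrite (gt_eqF x20) implybT.
rewrite powRr1 ?ltW//.
by field; rewrite gt_eqF ?(gt_eqF x0)//=; lra.
Unshelve. all: by end_near. Qed.

Lemma clifford0 nu : clifford nu 0 = 1.
Proof.
apply/cvg_lim => //; rewrite -cvg_shiftS/=.
rewrite (_ : (fun n => _) = cst 1); first exact: cvg_cst.
apply/funext => n; rewrite /pseries /series/= big_nat_recl//.
rewrite big1 => [|i _]; last by rewrite expr0n mulr0.
by rewrite /clifford_coef /pochhammer big_ord0 !(expr0, fact0, mulr1, mul1r, invr1, addr0).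
Qed.

(** [0] bounds the positive zeros from below, hence so does their infimum. *)
Lemma bessel_J_neq0 nu x : 0 < x < bessel_zero nu -> bessel_J nu x != 0.
Proof.
move=> /andP[x0 xj]; apply/eqP => J0; move: xj; apply/negP; rewrite -leNgt.
by apply: ge_inf => //; exists 0 => y /= [/ltW].
Qed.

(** The value at [0] is [1], so a nonpositive value would force a zero in
    between, which is a zero of [J_nu] below the first one. *)
Lemma clifford_gt0 nu z : 0 < nu -> 0 < bessel_zero nu ->
  0 <= z < bessel_zero nu ^+ 2 / 4 ->
  0 < clifford nu z.
Proof.
move=> nu0 j0 /andP[z0 zj]; rewrite ltNge; apply/negP => uz.
have cc : {within `[0, z], continuous (clifford nu)}.
  apply: continuous_subspaceT => t.
  exact: is_derive_continuous (clifford_derive t (ltW nu0)).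
have [|y] := @IVT _ (clifford nu) _ _ 0 z0 cc.
  by rewrite clifford0 ge_min uz orbT le_max ler01.
rewrite in_itv/= => /andP[y0 yz] cy0.
have {}y0 : 0 < y.
  rewrite lt_neqAle y0 andbT; apply/eqP => y0'.
  by move: cy0; rewrite -y0' clifford0 => /eqP; rewrite oner_eq0.
pose x := 2 * Num.sqrt y.
have xx : x ^+ 2 / 4 = y by rewrite /x exprMn sqr_sqrtr ?ltW//; field.
have x0 : 0 < x by rewrite mulr_gt0// sqrtr_gt0.
have : bessel_J nu x != 0.
  apply: bessel_J_neq0; rewrite x0/= -(ltr_pXn2r (n := 2)) ?nnegrE ?ltW//.
  by rewrite -(ltr_pM2r (x := 4^-1)) ?invr_gt0// xx (le_lt_trans yz).
by rewrite bessel_JE// xx cy0 mulr0 eqxx.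
Qed.

End bessel_clifford.

(** * One-variable profiles from the equation that defines c *)

Section lamb_profile.
Context {R : realType}.
Implicit Types (m nu lambda c t b : R) (w W : R -> R).

(** The data that the weighted inequality consumes on domains of inradius less
    than [b]: [w] weighs [`|f|], and [W], which dominates the profile [phi],
    weighs the gradient. *)
Definition test_profile b w W := exists Psi phi : R -> R,
  forall t, 0 < t < b -> [/\ is_derive t 1 Psi (phi t), derivable phi t 1,
    derive1 phi t <= - w t & 0 <= phi t <= W t].

Lemma test_profileZ b w W : 0 < b -> test_profile 1 w W ->
  test_profile b (fun t => w (t / b) / b ^+ 2) (fun t => W (t / b) / b).
Proof.
move=> b0 [Psi [phi H]].
exists (fun t => Psi (t / b)), (fun t => phi (t / b) / b) => t /andP[t0 tb].
have /H[dPsi dphi phi' phi0W] : 0 < t / b < 1.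
  by rewrite divr_gt0//= ltr_pdivrMr// mul1r.
have bN0 : b != 0 by rewrite gt_eqF.
have e1 : is_derive t 1 (fun y : R => y / b) b^-1.
  by apply: is_derive_eq; rewrite /GRing.scale/=; ring.
have d2 : is_derive (t / b) 1 phi (derive1 phi (t / b)).
  by rewrite derive1E; exact: derivableP.
have d3 : is_derive t 1 (fun y => phi (y / b)) (derive1 phi (t / b) * b^-1).
  exact: (is_derive1_comp (f := phi) (g := fun y => y / b) d2 e1).
have d4 : is_derive t 1 (fun y => phi (y / b) / b) (derive1 phi (t / b) / b ^+ 2).
  by apply: is_derive_eq; rewrite /GRing.scale/=; field.
split.
- exact: (is_derive1_comp (f := Psi) (g := fun y => y / b) dPsi e1).
- by case: d4.
- rewrite derive1E (@derive_val _ _ _ _ _ _ _ d4).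
  by rewrite -mulNr ler_pM2r// invr_gt0 exprn_gt0.
- by rewrite divr_ge0 ?(ltW b0)//= ?ler_pM2r ?invr_gt0//; case/andP: phi0W.
Qed.

Definition lamb_weight m nu c t : R :=
  (1 - nu ^+ 2 * m ^+ 2) / 4 / t ^+ 2 + c ^+ 2 * t `^ (m - 2).

(** With [u] the Bessel-Clifford function and [zt t = c^2 / m^2 * t `^ m], the
    function [Psi] is [ln y] up to a constant, where
    [y t = t `^ (1/2) * J_nu (2 / m * c * t `^ (m / 2))], and [psi] is its
    derivative: [t * psi t] is affine in [riccati u u1 (zt t)], which decreases
    from [0], and [psi 1 = lambda] is the equation that defines [c]. *)
Lemma lamb_profile m nu lambda c : 0 < m -> 0 < nu ->
  lamb_root nu m lambda c ->
  exists Psi psi : R -> R, [/\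
    forall t, 0 < t <= 1 -> is_derive t 1 Psi (psi t),
    forall t, 0 < t <= 1 ->
      is_derive t 1 psi (- (lamb_weight m nu c t + psi t ^+ 2)),
    psi 1 = lambda &
    forall t, 0 < t <= 1 -> lambda <= t * psi t <= (1 + nu * m) / 2].
Proof.
move=> m0 nu0 [root /andP[x0 xj]].
have nu0' := ltW nu0.
have c0 : 0 < c by move: x0; rewrite pmulr_rgt0// divr_gt0.
have j0 := lt_trans x0 xj.
set j := bessel_zero nu in xj j0 *.
pose u := clifford nu; pose u1 z : R := - (nu + 1)^-1 * clifford (nu + 1) z.
pose u2 z : R := (nu + 1)^-1 * ((nu + 2)^-1 * clifford (nu + 2) z).
pose z1 := j ^+ 2 / 4.
have nu1N0 : nu + 1 != 0 by rewrite gt_eqF//; lra.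
have nu2N0 : nu + 2 != 0 by rewrite gt_eqF//; lra.
have du (z : R) : is_derive z 1 u (u1 z) by exact: clifford_derive.
have du1 (z : R) : is_derive z 1 u1 (u2 z).
  have nu10 : 0 <= nu + 1 by lra.
  have := clifford_derive z nu10 => d; rewrite /u1; apply: is_derive_eq.
  rewrite /GRing.scale/= /u2 (_ : nu + 1 + 1 = nu + 2); last by ring.
  by ring.
have ode (z : R) : z * u2 z + (nu + 1) * u1 z + u z = 0.
  rewrite -(clifford_contiguous z nu0') /u /u1 /u2.
  by field; rewrite nu1N0 nu2N0.
have u0 (z : R) : 0 <= z < z1 -> 0 < u z by exact: clifford_gt0.
pose r := riccati u u1.
pose a := (1 + nu * m) / 2.
pose zt t : R := c ^+ 2 / m ^+ 2 * t `^ m.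
have cm0 : 0 < c ^+ 2 / m ^+ 2 by rewrite divr_gt0// exprn_gt0.
have zt1 : zt 1 = c ^+ 2 / m ^+ 2 by rewrite /zt powR1 mulr1.
have zt1lt : zt 1 < z1.
  have -> : zt 1 = (2 / m * c) ^+ 2 / 4 by rewrite zt1; field; rewrite gt_eqF.
  by rewrite /z1 ltr_pM2r ?invr_gt0// ltr_pXn2r ?nnegrE// ltW.
have zt_gt0 t : 0 < t -> 0 < zt t by move=> t0; rewrite mulr_gt0// powR_gt0.
have zt_le t : 0 < t <= 1 -> zt t <= zt 1.
  move=> /andP[t0 t1]; rewrite /zt ler_pM2l// ge0_ler_powR ?nnegrE// ltW//.
have ztP t : 0 < t <= 1 -> 0 < zt t < z1.
  move=> tt; rewrite zt_gt0/= ?(le_lt_trans (zt_le _ tt))//.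
  by case/andP: tt.
pose psi t : R := (a + m * r (zt t)) / t.
pose Psi t : R := a * ln t + ln (u (zt t)).
have dzt t : 0 < t -> is_derive t 1 zt (m * zt t / t).
  move=> t0; have := is_derive1_powR m t0 => dp; rewrite /zt.
  apply: is_derive_eq; rewrite /GRing.scale/= powRB; last first.
    by rewrite (gt_eqF t0) implybT.
  by rewrite powRr1 ?ltW//; field; rewrite !gt_eqF.
have psi1 : psi 1 = lambda.
  rewrite /psi divr1 zt1.
  have J0 : bessel_J nu (2 / m * c) != 0 by apply: bessel_J_neq0; rewrite x0.
  have zE : (2 / m * c) ^+ 2 / 4 = c ^+ 2 / m ^+ 2 by field; rewrite gt_eqF.
  have := @bessel_J_derive _ _ (2 / m * c) nu0 x0; rewrite zE -/(u1 _) -/(u _) => dJ.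
  move: J0 root; rewrite bessel_JE// zE -/(u _).
  set K := bessel_scale nu * _ `^ nu in dJ *.
  rewrite mulf_eq0 negb_or => /andP[K0 uN0].
  have -> : 2 * c * derive1 (bessel_J nu) (2 / m * c) =
      m * (2 / m * c * derive1 (bessel_J nu) (2 / m * c)).
    by rewrite !mulrA; congr (_ * _); field; rewrite gt_eqF.
  rewrite dJ => root.
  have {}root : (1 - 2 * lambda) * u (c ^+ 2 / m ^+ 2) +
      m * (nu * u (c ^+ 2 / m ^+ 2)
           + 2 * (c ^+ 2 / m ^+ 2) * u1 (c ^+ 2 / m ^+ 2)) = 0.
    apply: (mulfI K0); rewrite mulr0 -[RHS]root; ring.
  rewrite /r /riccati /a.
  set z0 := c ^+ 2 / m ^+ 2 in root uN0 *.
  have -> : z0 * u1 z0 = - ((1 - 2 * lambda) * u z0 + m * nu * u z0) / m / 2.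
    have -> : (1 - 2 * lambda) * u z0 = - (m * (nu * u z0 + 2 * z0 * u1 z0)) by lra.
    by field; rewrite gt_eqF.
  by field; rewrite uN0 gt_eqF.
exists Psi, psi; split; [|  |exact: psi1|]; move=> t tt; have /andP[t0 t1] := tt.
- have ut : 0 < u (zt t).
    by apply: u0; case/andP: (ztP _ tt) => /ltW -> ->.
  have d1 := is_derive1_ln t0; have d2 := is_derive1_ln ut.
  have d3 : is_derive t 1 (u \o zt) (u1 (zt t) * (m * zt t / t)).
    exact: (is_derive1_comp (du _) (dzt _ t0)).
  have d4 : is_derive t 1 (@ln R \o (u \o zt))
      ((u (zt t))^-1 * (u1 (zt t) * (m * zt t / t))).
    exact: (is_derive1_comp (g := u \o zt) d2 d3).
  have d5 : is_derive t 1 (fun t => a * ln t) (a / t).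
    by apply: is_derive_eq; rewrite /GRing.scale/=; ring.
  apply: (is_derive_eq (is_deriveD d5 d4)).
  by rewrite /psi /r /riccati; field; rewrite !gt_eqF.
- have dr := @riccati_derive _ nu z1 u u1 u2 du du1 ode u0 _ (ztP _ tt).
  have d1 : is_derive t 1 (r \o zt) _ := is_derive1_comp dr (dzt _ t0).
  have tN0 : t != 0 by rewrite gt_eqF.
  have d2 : is_derive t 1 (fun y : R => y^-1) (- t ^- 2 *: 1).
    exact: (is_deriveV (f := id) tN0).
  have d3 : is_derive t 1 (fun y => m * (r \o zt) y) (m *: _) := is_deriveZ m d1.
  have d4 : is_derive t 1 (fun y => a + m * (r \o zt) y) (0 + _) :=
    is_deriveD (is_derive_cst a t 1) d3.
  apply: (is_derive_eq (is_deriveM d4 d2)); rewrite /GRing.scale/=.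
  rewrite -/r /psi /lamb_weight powRB; last by rewrite tN0 implybT.
  rewrite (@powR_mulrn _ t 2) ?(ltW t0)//.
  have tme : t `^ m = zt t * m ^+ 2 / c ^+ 2.
    by rewrite /zt; field; rewrite !gt_eqF.
  rewrite tme /a; have := zt_gt0 _ t0; move: (zt t) => z z0.
  by field; rewrite !gt_eqF.
- have rt : t * psi t = a + m * r (zt t) by rewrite /psi mulrC divfK// gt_eqF.
  have r0 : r 0 = 0 by rewrite /r /riccati !mul0r.
  have nincr x y : 0 <= x -> x <= y -> y < z1 -> r y <= r x.
    exact: (@riccati_nincr _ nu z1 u u1 u2 nu0 du du1 ode u0).
  rewrite rt; apply/andP; split.
    rewrite -psi1 /psi divr1 lerD2l ler_pM2l//.
    by apply: nincr; [rewrite ltW// zt_gt0|exact: zt_le|exact: zt1lt].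
  rewrite gerDl pmulr_rle0// -r0; apply: nincr => //.
    by rewrite ltW// zt_gt0.
  by case/andP: (ztP _ tt).
Qed.

End lamb_profile.

Section lamb_test_profiles.
Context {R : realType}.
Implicit Types (m nu lambda c t b : R) (w W : R -> R).

Definition scaled_lamb_weight m nu c b t : R :=
  (1 - nu ^+ 2 * m ^+ 2) / 4 / t ^+ 2 + c ^+ 2 / b `^ m / t `^ (2 - m).

Lemma scaled_lamb_weightE m nu c b t : 0 < b -> 0 < t ->
  lamb_weight m nu c (t / b) / b ^+ 2 = scaled_lamb_weight m nu c b t.
Proof.
move=> b0 t0; rewrite /lamb_weight /scaled_lamb_weight.
have -> : 2 - m = - (m - 2) by ring.
rewrite powRN powRM ?invr_ge0 ?ltW// -(powR_inv1 (ltW b0)) -powRrM.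
rewrite (_ : -1 * (m - 2) = 2 - m); last by ring.
rewrite (powRB (x := b)); last by rewrite (gt_eqF b0) implybT.
rewrite (@powR_mulrn _ b 2) ?(ltW b0)// (powR_inv1 (ltW b0)) invrK.
have := powR_gt0 m b0; move: (b `^ m) (t `^ _) => B T B0.
by field; rewrite !gt_eqF.
Qed.

Lemma lamb_weight_ge0 m nu c t : 0 < m -> 0 < nu -> nu * m <= 1 ->
  0 <= lamb_weight m nu c t.
Proof.
move=> m0 nu0 num; have num0 : 0 <= nu * m by rewrite mulr_ge0 ?ltW.
rewrite /lamb_weight addr_ge0 ?divr_ge0 ?sqr_ge0//; last first.
  by rewrite mulr_ge0 ?powR_ge0 ?sqr_ge0.
by rewrite -exprMn subr_ge0 expr_le1.
Qed.

Lemma lamb_psi_ge m nu c (psi : R -> R) t : 0 < m -> 0 < nu -> nu * m <= 1 ->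
  (forall t, 0 < t <= 1 ->
      is_derive t 1 psi (- (lamb_weight m nu c t + psi t ^+ 2))) ->
  0 < t <= 1 -> psi 1 <= psi t.
Proof.
move=> m0 nu0 num dpsi /andP[t0]; rewrite le_eqVlt => /predU1P[->//|t1].
have cpsi : {within `[t, 1], continuous psi}.
  apply/subspace_continuousP => x /=; rewrite in_itv/= => /andP[tx x1].
  apply: cvg_within_filter; apply: is_derive_continuous (dpsi x _).
  by rewrite (lt_le_trans t0 tx).
have dpsi' x : x \in `]t, 1[ -> is_derive x 1 psi (- (lamb_weight m nu c x + psi x ^+ 2)).
  rewrite in_itv/= => /andP[tx x1]; apply: dpsi.
  by rewrite (lt_trans t0 tx) ltW.
have [x] := MVT t1 dpsi' cpsi; rewrite in_itv/= => /andP[tx x1] E.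
rewrite -subr_le0 E mulr_le0_ge0 ?subr_ge0//; last by rewrite ltW.
by rewrite oppr_le0 addr_ge0 ?sqr_ge0// lamb_weight_ge0.
Qed.

Lemma eq_test_profile b w w' W W' :
  (forall t, 0 < t < b -> w t = w' t) -> (forall t, 0 < t < b -> W t = W' t) ->
  test_profile b w W -> test_profile b w' W'.
Proof.
move=> ww WW [Psi [phi H]]; exists Psi, phi => t tb.
by rewrite -ww// -WW//; exact: H.
Qed.

(** The square [psi ^+ 2] in the Riccati equation is kept only through
    [lambda ^+ 2 / t ^+ 2], which it dominates. *)
Lemma lamb_test_profile_ge0 m nu lambda c b : 0 < m -> 0 < nu -> nu * m <= 1 ->
  0 <= lambda < (1 + nu * m) / 2 -> lamb_root nu m lambda c -> 0 < b ->
  test_profile b (scaled_lamb_weight m nu c b)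
    (fun t => ((1 + nu * m) / 2 - lambda ^+ 2) / t + (lambda ^+ 2 - lambda) / b).
Proof.
move=> m0 nu0 num /andP[l0 l1] root b0.
have [Psi [psi [dPsi dpsi psi1 psiB]]] := lamb_profile m0 nu0 root.
have : test_profile 1 (lamb_weight m nu c)
    (fun t => ((1 + nu * m) / 2 - lambda ^+ 2) / t + (lambda ^+ 2 - lambda)).
  exists (fun t => Psi t + (lambda ^+ 2 - lambda) * t - lambda ^+ 2 * ln t).
  exists (fun t => psi t + (lambda ^+ 2 - lambda) - lambda ^+ 2 / t) => t /andP[t0 t1].
  have tt : 0 < t <= 1 by rewrite t0 ltW.
  have d1 := dPsi _ tt; have d2 := dpsi _ tt; have d3 := is_derive1_ln t0.
  have tN0 : t != 0 by rewrite gt_eqF.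
  have d4 : is_derive t 1 (fun y : R => y^-1) (- t ^- 2 *: 1).
    exact: (is_deriveV (f := id) tN0).
  have d5 : is_derive t 1 (fun t => psi t + (lambda ^+ 2 - lambda) - lambda ^+ 2 / t)
      (- (lamb_weight m nu c t + psi t ^+ 2) + lambda ^+ 2 / t ^+ 2).
    by apply: is_derive_eq; rewrite /GRing.scale/=; field.
  have /andP[pl pu] := psiB _ tt.
  have plt : lambda / t <= psi t by rewrite ler_pdivrMr// mulrC.
  have put : psi t <= (1 + nu * m) / 2 / t by rewrite ler_pdivlMr// mulrC.
  split.
  - by apply: is_derive_eq; rewrite /GRing.scale/=; field.
  - by case: d5.
  - rewrite derive1E (@derive_val _ _ _ _ _ _ _ d5) opprD -addrA gerDl.
    rewrite -expr_div_n addrC subr_le0 ler_pXn2r ?nnegrE// ?divr_ge0 ?(ltW t0)//.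
    by rewrite (le_trans _ plt) ?divr_ge0 ?(ltW t0).
  - apply/andP; split; last by rewrite mulrBl -!addrA; lra.
    suff : 0 <= (lambda - lambda ^+ 2) * (t^-1 - 1) by lra.
    have t1' : 1 <= t^-1 by rewrite invf_ge1// ltW.
    by rewrite mulr_ge0// ?subr_ge0// expr2 ler_piMl//; lra.
move=> /(test_profileZ b0); apply: eq_test_profile => t /andP[t0 tb].
  exact: scaled_lamb_weightE.
by field; rewrite !gt_eqF.
Qed.

(** Here the square [psi ^+ 2] is dropped. *)
Lemma lamb_test_profile_le0 m nu lambda c b : 0 < m -> 0 < nu -> nu * m <= 1 ->
  lamb_root nu m lambda c -> 0 < b ->
  test_profile b (scaled_lamb_weight m nu c b)
    (fun t => (1 + nu * m) / 2 / t - lambda / b).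
Proof.
move=> m0 nu0 num root b0.
have [Psi [psi [dPsi dpsi psi1 psiB]]] := lamb_profile m0 nu0 root.
have : test_profile 1 (lamb_weight m nu c) (fun t => (1 + nu * m) / 2 / t - lambda).
  exists (fun t => Psi t - lambda * t), (fun t => psi t - lambda) => t /andP[t0 t1].
  have tt : 0 < t <= 1 by rewrite t0 ltW.
  have d1 := dPsi _ tt; have d2 := dpsi _ tt.
  have d5 : is_derive t 1 (fun t => psi t - lambda)
      (- (lamb_weight m nu c t + psi t ^+ 2)).
    by apply: is_derive_eq; rewrite subr0.
  have /andP[pl pu] := psiB _ tt.
  split.
  - by apply: is_derive_eq; rewrite /GRing.scale/=; ring.
  - by case: d5.
  - by rewrite derive1E (@derive_val _ _ _ _ _ _ _ d5) opprD gerDl oppr_le0 sqr_ge0.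
  - rewrite subr_ge0 -{1}psi1 (lamb_psi_ge _ _ _ dpsi)//=.
    by rewrite lerD2r ler_pdivlMr// mulrC.
move=> /(test_profileZ b0); apply: eq_test_profile => t /andP[t0 tb].
  exact: scaled_lamb_weightE.
by field; rewrite !gt_eqF.
Qed.

End lamb_test_profiles.

(** * Translation invariance of Lebesgue measure *)

Section lebesgue_translation.
Context {R : realType}.

Lemma lebesgue_measure_translation (a : R) (A : set (measurableTypeR R)) :
  measurable A ->
  lebesgue_measure ((fun x : R => x + a) @^-1` A) = lebesgue_measure A.
Proof.
move=> mA.
have mf : measurable_fun setT (fun x : measurableTypeR R => (x + a) : measurableTypeR R).
  exact: measurable_funD.
pose mu : {measure set (measurableTypeR R) -> \bar R} :=
  pushforward (@lebesgue_measure R) (fun x : measurableTypeR R => (x + a) : measurableTypeR R).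
rewrite -[LHS]/(mu mf A); apply/esym/lebesgue_measure_unique => // X.
move=> [[x y] _ <-] /=; rewrite /pushforward.
have -> : (fun x0 : R => x0 + a) @^-1` `]x, y]%classic = `]x - a, y - a]%classic.
  by apply/seteqP; split => z /=; rewrite !in_itv/= ltrBlDr lerBrDr.
by rewrite !lebesgue_measure_itv/= !lte_fin ltrD2r -!EFinB opprB addrA subrK.
Qed.

Lemma measurable_rV_shift n (v : 'rV[R]_n) :
  measurable_fun setT (fun x : 'rV[R]_n => x + v).
Proof.
apply: measurable_fun_rV => i.
rewrite (_ : _ \o _ = fun x => rV_coord i x + v 0 i); last first.
  by apply/funext => x; rewrite /rV_coord/= mxE.
by apply: measurable_funD => //; exact: measurable_rV_coord.
Qed.

(** Both sides are measures that agree on rectangles, so uniqueness of the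
    product measure carries the one-dimensional case to every dimension. *)
Lemma lebesgue_rV_translation n (v : 'rV[R]_n) (A : set 'rV[R]_n) :
  measurable A -> lebesgue_rV ((fun x => x + v) @^-1` A) = lebesgue_rV A.
Proof.
elim: n v A => [|n IH] v A mA.
  congr (lebesgue_rV _); apply/seteqP; split => x /=; rewrite (_ : x + v = x)//;
    by apply/rowP; case.
have mB : measurable (@rV_cons R n @^-1` A).
  by rewrite -[X in measurable X]setTI; exact: measurable_rV_cons.
pose v' : 'rV[R]_n := \row_j v 0 (lift ord0 j).
pose sh (p : measurableTypeR R * 'rV[R]_n) : measurableTypeR R * 'rV[R]_n :=
  (p.1 + v 0 ord0, p.2 + v').
have msh : measurable_fun setT sh.
  apply: measurable_fun_pair => /=.
    by apply: (@measurable_funD _ _ R setT fst (fun=> v 0 ord0)).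
  exact: (measurableT_comp (measurable_rV_shift v') measurable_snd).
rewrite /lebesgue_rV /= /lebesgue_rV_step /pushforward.
have -> : @rV_cons R n @^-1` ((fun x => x + v) @^-1` A) = sh @^-1` (@rV_cons R n @^-1` A).
  apply/seteqP; split => -[x y] /=; rewrite (_ : rV_cons (x, y) + v = rV_cons (sh (x, y)))//;
  by apply/rowP => i; rewrite !mxE; case: (unliftP ord0 i) => [j|] -> /=;
     rewrite ?mxE.
pose m' : {measure set (measurableTypeR R * 'rV[R]_n) -> \bar R} :=
  pushforward (@lebesgue_measure R \x @lebesgue_rV_rec R n)%E sh.
rewrite -[LHS]/(m' msh (@rV_cons R n @^-1` A)).
apply/esym/product_measure_unique => // X Y mX mY; rewrite /m' /= /pushforward.
have -> : sh @^-1` (X `*` Y) =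
    ((fun x : R => x + v 0 ord0) @^-1` X) `*` ((fun x => x + v') @^-1` Y).
  by apply/seteqP; split => -[x y].
rewrite [LHS]product_measure1E//.
- by congr (_ * _)%E; [exact: lebesgue_measure_translation|exact: IH].
- rewrite -[X in measurable X]setTI.
  have mf : measurable_fun setT (fun x : measurableTypeR R => (x + v 0 ord0) : measurableTypeR R).
    exact: measurable_funD.
  exact: mf.
- by rewrite -[X in measurable X]setTI; exact: measurable_rV_shift.
Qed.

Lemma integral_rV_translation n (v : 'rV[R]_n) (F : 'rV[R]_n -> R) :
  lebesgue_rV.-integrable setT (EFin \o F) ->
  lebesgue_rV.-integrable setT (EFin \o (fun x => F (x + v))) /\
  \int[lebesgue_rV]_x F (x + v) = \int[lebesgue_rV]_x F x.
Proof.
move=> iF.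
have mF : measurable_fun setT (EFin \o F) by have /integrableP[] := iF.
have mv := measurable_rV_shift v.
pose m' : {measure set 'rV[R]_n -> \bar R} :=
  pushforward (@lebesgue_rV R n) (fun x : 'rV[R]_n => x + v).
have m'E A : measurable A -> A `<=` setT -> m' mv A = lebesgue_rV A.
  by move=> mA _; exact: lebesgue_rV_translation.
have iFv : lebesgue_rV.-integrable setT (EFin \o (fun x => F (x + v))).
  apply/integrableP; split; first exact: (measurableT_comp mF mv).
  have /integrableP[_] := iF; apply: le_lt_trans.
  rewrite -[X in (_ <= X)%E](eq_measure_integral _ m'E) /m'.
  rewrite ge0_integral_pushforward//.
  exact: (measurableT_comp (@abse_measurable _ setT) mF).
split => //; rewrite /Rintegral; congr fine.
rewrite -[RHS](eq_measure_integral _ m'E) /m'.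
by rewrite (integral_pushforward mv mF)//.
Qed.

End lebesgue_translation.

(** * Integration of bounded functions with bounded support *)

Section borel_rV.
Context {R : realType} {n : nat}.
Implicit Types (A K : set 'rV[R]_n) (f g : 'rV[R]_n -> R).

Lemma measurable_rV_forall (B : 'I_n -> set R) :
  (forall i, measurable (B i)) ->
  measurable [set x : 'rV[R]_n | forall i, B i (x 0 i)].
Proof.
move=> mB.
rewrite (_ : mkset _ = \bigcap_i (rV_coord i @^-1` B i)); last first.
  by apply/seteqP; split => x /= h i; [move=> _|]; exact: h.
apply: fin_bigcap_measurable => // i _; rewrite -[X in measurable X]setTI.
by apply: measurable_rV_coord => //; exact: mB.
Qed.

(** An open set is the union of the rational cubes that it contains. *)
Lemma measurable_open_rV A : open A -> measurable A.
Proof.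
move=> oA.
pose box (p : 'rV[rat]_n * nat) : set 'rV[R]_n :=
  [set x | forall i, ball (ratr (p.1 0 i) : R) p.2.+1%:R^-1 (x 0 i)].
pose F p := [set x | box p x /\ box p `<=` A].
have -> : A = \bigcup_p F p.
  apply/seteqP; split => [x Ax|x [p _]]; last first.
    by move=> [xb]; exact.
  have /nbhs_ballP[r /= r0 rA] : nbhs x A by apply: open_nbhs_nbhs.
  pose k := Num.bound (2 / r); pose e : R := k.+1%:R^-1.
  have e0 : 0 < e by rewrite invr_gt0.
  have er : e + e < r.
    have : 2 / r < k.+1%:R.
      apply: (@lt_le_trans _ _ k%:R); last by rewrite ler_nat.
      by apply: archi_boundP; rewrite divr_ge0// ltW.
    have k0 : 0 < k.+1%:R :> R by rewrite ltr0n.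
    by rewrite ltr_pdivrMr// mulrC -ltr_pdivrMr// -/e => h; lra.
  have qP i : {q : rat | ratr q \in `](x 0 i - e), (x 0 i + e)[}.
    by apply/cid; apply: rat_in_itvoo; lra.
  pose q : 'rV[rat]_n := \row_i projT1 (qP i).
  have xq i : `|ratr (q 0 i) - x 0 i| < e.
    rewrite mxE; case: (qP i) => t /=; rewrite in_itv/= => h.
    by rewrite ltr_norml; lra.
  exists (q, k) => //; split; first by move=> i; exact: xq.
  move=> y yb; apply: rA; split => // i j; have -> : i = 0 by rewrite ord1.
  have := yb j; rewrite /ball/= => h1; have := xq j => h2.
  apply: le_lt_trans er.
  rewrite -(subrKA (ratr (q 0 j))) (le_trans (ler_normD _ _))// lerD// ltW//.
  by rewrite distrC.
apply: countable_bigcupT_measurable => // p.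
have [pA|pA] := pselect (box p `<=` A).
  rewrite (_ : F p = box p); last by apply/seteqP; split => x // [].
  apply: (@measurable_rV_forall (fun i => ball (ratr (p.1 0 i) : R) p.2.+1%:R^-1)).
  by move=> i; exact: measurable_ball.
by rewrite (_ : F p = set0)//; apply/seteqP; split => x // [].
Qed.

Lemma measurable_continuous_rV A f : open A ->
  (forall x, A x -> {for x, continuous f}) -> measurable_fun A f.
Proof.
move=> oA cf; apply: (measurability _ (RGenOpens.measurableE R)).
move=> _ [_ [a [b ->] <-]]; apply: measurable_open_rV.
rewrite openE => x [Ax fx]; apply: filterI; first exact: oA.
by apply: cf => //; apply: open_nbhs_nbhs; split => //; exact: interval_open.
Qed.

Lemma coord_norm_le (v : 'rV[R]_n) i : `|v 0 i| <= `|v|.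
Proof.
rewrite [leRHS]/Num.Def.normr/= mx_normrE.
exact: (le_bigmax _ (fun ij : 'I_1 * 'I_n => `|v ij.1 ij.2|) (0, i)).
Qed.

(** A class of integrable functions that is closed under translations and
    linear combinations; domination ([tame_le]) gives membership. *)
Definition tame f := [/\ measurable_fun setT f, exists M, forall x, `|f x| <= M &
  exists B, forall x, f x != 0 -> forall i, `|x 0 i| <= B].

Lemma tame_integrable f : tame f -> lebesgue_rV.-integrable setT (EFin \o f).
Proof.
move=> [mf [M fM] [B fB]].
pose bx := [set x : 'rV[R]_n | forall i, `[- B, B]%classic (x 0 i)].
have mb : measurable bx.
  by apply: (@measurable_rV_forall (fun=> `[- B, B]%classic)) => i.
have fE : f = f \_ bx.
  apply/funext => x; rewrite patchE; case: ifPn => //; rewrite notin_setE => xb.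
  apply/eqP; apply: contra_notT xb => /fB h i /=.
  by rewrite in_itv/= -ler_norml.
have bfin : (lebesgue_rV bx < +oo)%E.
  rewrite (lebesgue_rV_box (A := fun=> `[- B, B]%classic))//.
  rewrite -ge0_fin_numE ?prode_ge0//; apply: prode_fin_num => i _.
  by rewrite lebesgue_measure_itv/=; case: ifP.
rewrite (_ : EFin \o f = (EFin \o f) \_ bx); last first.
  by rewrite [in LHS]fE; apply/funext => x /=; rewrite !patchE; case: ifP.
apply/integrable_restrict => //; rewrite setTI.
apply: measurable_bounded_integrable => //; first exact: measurable_funTS.
exists M; split; first exact: num_real.
by move=> y My x _ /=; rewrite (le_trans (fM x))// ltW.
Qed.

Lemma tame_le f g c : tame f -> measurable_fun setT g ->
  (forall x, `|g x| <= c * `|f x|) -> tame g.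
Proof.
move=> [mf [M fM] [B fB]] mg gf; split => //.
  exists (`|c| * M) => x; apply: (le_trans (gf x)).
  by rewrite (le_trans (ler_norm _))// normrM normr_id ler_wpM2l.
exists B => x gx; apply: fB; apply: contra_neq gx => fx.
by apply/eqP; rewrite -normr_le0 (le_trans (gf x))// fx normr0 mulr0.
Qed.

Lemma tameD f g : tame f -> tame g -> tame (fun x => f x + g x).
Proof.
move=> [mf [M fM] [B fB]] [mg [N gN] [C gC]]; split.
- exact: measurable_funD.
- by exists (M + N) => x; rewrite (le_trans (ler_normD _ _))// lerD.
- exists (Num.max B C) => x fg i; rewrite le_max.
  have [f0|/fB ->//] := eqVneq (f x) 0.
  by rewrite gC ?orbT//; apply: contra_neq fg => ->; rewrite f0 addr0.
Qed.

Lemma tameZ f c : tame f -> tame (fun x => c * f x).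
Proof.
move=> tf; have [mf _ _] := tf; apply: (tame_le (c := `|c|)) tf _ _.
  by apply: measurable_funM.
by move=> x; rewrite normrM.
Qed.

Lemma tame_sum (I : Type) (s : seq I) (F : I -> 'rV[R]_n -> R) :
  (forall i, tame (F i)) -> tame (fun x => \sum_(i <- s) F i x).
Proof.
move=> tF; elim: s => [|i s ih].
  under eq_fun do rewrite big_nil; split; [exact: measurable_cst| |].
    by exists 0 => x; rewrite normr0.
  by exists 0 => x; rewrite eqxx.
by under eq_fun do rewrite big_cons; exact: tameD.
Qed.

Lemma tame_shift f v : tame f -> tame (fun x => f (x + v)).
Proof.
move=> [mf [M fM] [B fB]]; split.
- exact: (measurableT_comp mf (measurable_rV_shift v)).
- by exists M.
- exists (B + `|v|) => x /fB xB i; have := xB i; rewrite mxE => xvB.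
  rewrite -[x 0 i](addrK (v 0 i)) (le_trans (ler_normB _ _))// lerD//.
  exact: coord_norm_le.
Qed.
End borel_rV.

Section tame_patch.
Context {R : realType} {n : nat}.
Implicit Types (A K : set 'rV[R]_n) (f g u Q : 'rV[R]_n -> R).

Lemma tame_patch A K f : open A -> compact K -> K `<=` A ->
  (forall x, A x -> {for x, continuous f}) ->
  (forall x, A x -> ~ K x -> f x = 0) -> tame (f \_ A).
Proof.
move=> oA cK KA cf f0.
have fK x : (f \_ A) x != 0 -> K x.
  rewrite patchE; case: ifPn => [/set_mem Ax|_]; last by rewrite eqxx.
  by apply: contra_neqP; exact: f0.
have bnd (V : normedModType R) (B : set V) : compact B ->
    exists M, forall x, B x -> `|x| <= M.
  move=> /compact_bounded [M [_ h]]; exists (M + 1) => x Bx.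
  by apply: h => //; rewrite ltrDl.
split.
- apply: (measurable_restrictT f (measurable_open_rV oA)).1.
  exact: measurable_continuous_rV.
- have : compact (f @` K).
    apply: continuous_compact => //; apply: continuous_in_subspaceT => x xK.
    by apply: cf; apply: KA; exact: set_mem.
  move=> /bnd[M fM]; exists (Num.max M 0) => x.
  have [->|/[dup] fx /fK Kx] := eqVneq ((f \_ A) x) 0.
    by rewrite normr0 le_max lexx orbT.
  by rewrite le_max patchE mem_set ?fM//; exact: KA.
- have [M KM] := bnd _ _ cK; exists M => x /fK /KM xM i.
  exact: le_trans (coord_norm_le _ _) xM.
Qed.

(** Translating the backward part of the second difference by [v] turns it into
    a forward one. *)
Lemma summation_by_parts u Q v :
  tame (fun x => u x * (Q x - Q (x + v))) ->
  tame (fun x => u x * (Q x - Q (x - v))) ->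
  tame (fun x => (u (x + v) - u x) * (Q (x + v) - Q x)) /\
  \int[lebesgue_rV]_x (u x * (2 * Q x - Q (x + v) - Q (x - v))) =
  \int[lebesgue_rV]_x ((u (x + v) - u x) * (Q (x + v) - Q x)).
Proof.
move=> t1 t2; have t3 := tame_shift v t2.
have E x : u (x + v) * (Q (x + v) - Q (x + v - v)) + u x * (Q x - Q (x + v)) =
    (u (x + v) - u x) * (Q (x + v) - Q x) by rewrite addrK; ring.
split.
  by under eq_fun do rewrite -E; exact: tameD.
have [_ T] := integral_rV_translation v (tame_integrable t2).
transitivity (\int[lebesgue_rV]_x
   (u x * (Q x - Q (x - v)) + u x * (Q x - Q (x + v)))).
  by congr Rintegral; apply/funext => x; ring.
rewrite RintegralD//; [|exact: tame_integrable..].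
rewrite -T -RintegralD//; [|exact: tame_integrable..].
by congr Rintegral; apply/funext => x; exact: E.
Qed.

End tame_patch.

(** Continuity is asked at the points of [K] but in the whole space, so that
    [y] may lie outside [K]. *)
Lemma compact_unif_continuous {R : realType} (V W : normedModType R) (K : set V)
    (f : V -> W) (e : R) : compact K -> (forall x, K x -> {for x, continuous f}) ->
  0 < e -> exists2 r : R, 0 < r &
    forall x y, K x -> `|x - y| < r -> `|f x - f y| < e.
Proof.
move=> /compact_near_coveringP cK cf e0.
pose P (r : R) (x : V) := forall y, `|x - y| < r -> `|f x - f y| < e.
have : \forall r \near 0^'+, K `<=` P r.
  apply: cK => x Kx.
  have e20 : 0 < e / 2 by rewrite divr_gt0.
  have /cvgrPdist_lt/(_ _ e20)/nbhs_ballP[d /= d0 dP] := cf _ Kx.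
  have d20 : 0 < d / 2 by rewrite divr_gt0.
  near=> x' r => y x'y.
  have xx' : `|x - x'| < d / 2.
    by near: x'; apply/nbhs_ballP; exists (d / 2) => //= z; rewrite -ball_normE.
  have rd : r < d / 2 by near: r; exact: nbhs_right_lt.
  have h1 : `|f x - f x'| < e / 2.
    by apply: dP; rewrite -ball_normE/=; lra.
  have h2 : `|f x - f y| < e / 2.
    apply: dP; rewrite -ball_normE/= -(subrKA x') (le_lt_trans (ler_normD _ _))//.
    by rewrite (splitr d) ltrD// (lt_trans x'y).
  rewrite -(subrKA (f x)) (le_lt_trans (ler_normD _ _))//.
  by rewrite (splitr e) ltrD// distrC.
move=> [r /= r0 rP]; exists (r / 2); first by rewrite divr_gt0.
move=> x y Kx xy; apply: (rP (r / 2)) => //=.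
- by rewrite sub0r normrN gtr0_norm ?divr_gt0//; lra.
- by rewrite divr_gt0.
Unshelve. all: by end_near. Qed.

Section tame_integral.
Context {R : realType} {n : nat}.
Implicit Types f g : 'rV[R]_n -> R.
Local Notation I g := (\int[lebesgue_rV]_x g x).

Lemma tame_intD f g : tame f -> tame g -> I (fun x => f x + g x) = I f + I g.
Proof. by move=> tf tg; rewrite RintegralD//; exact: tame_integrable. Qed.

Lemma tame_intZ f c : tame f -> I (fun x => c * f x) = c * I f.
Proof. by move=> tf; rewrite RintegralZl//; exact: tame_integrable. Qed.

Lemma tame_intB f g : tame f -> tame g -> I (fun x => f x - g x) = I f - I g.
Proof. by move=> tf tg; rewrite RintegralB//; exact: tame_integrable. Qed.

Lemma tame_int_sum (J : Type) (s : seq J) (F : J -> 'rV[R]_n -> R) :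
  (forall i, tame (F i)) ->
  I (fun x => \sum_(i <- s) F i x) = \sum_(i <- s) I (F i).
Proof.
move=> tF; elim: s => [|i s ih].
  rewrite big_nil; under eq_Rintegral do rewrite big_nil.
  by rewrite Rintegral_cst// mul0r.
rewrite big_cons -ih -tame_intD//; last exact: tame_sum.
by congr Rintegral; apply/funext => x; rewrite big_cons.
Qed.

Lemma tame_int_le f g : tame f -> tame g -> (forall x, f x <= g x) -> I f <= I g.
Proof. by move=> tf tg fg; apply: le_Rintegral => //; exact: tame_integrable. Qed.

End tame_integral.

(** * The Euclidean norm and the distance to the complement *)

Section euclidean_norm.
Context {R : realType} {n : nat}.
Implicit Types (x y z : 'rV[R]_n) (a : R).

Definition edot x y : R := \sum_(i < n) x 0 i * y 0 i.

Lemma edotC x y : edot x y = edot y x.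
Proof. by apply: eq_bigr => i _; rewrite mulrC. Qed.

Lemma edotDr x y z : edot x (y + z) = edot x y + edot x z.
Proof. by rewrite -big_split; apply: eq_bigr => i _; rewrite mxE mulrDr. Qed.

Lemma edotZr a x y : edot x (a *: y) = a * edot x y.
Proof. by rewrite mulr_sumr; apply: eq_bigr => i _; rewrite mxE mulrCA. Qed.

Lemma edotNr x y : edot x (- y) = - edot x y.
Proof. by rewrite -scaleN1r edotZr mulN1r. Qed.

Lemma edotBr x y z : edot x (y - z) = edot x y - edot x z.
Proof. by rewrite edotDr edotNr. Qed.

Lemma edotDl x y z : edot (x + y) z = edot x z + edot y z.
Proof. by rewrite !(edotC _ z) edotDr. Qed.

Lemma edotZl a x y : edot (a *: x) y = a * edot x y.
Proof. by rewrite !(edotC _ y) edotZr. Qed.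

Lemma edotNl x y : edot (- x) y = - edot x y.
Proof. by rewrite !(edotC _ y) edotNr. Qed.

Lemma edotBl x y z : edot (x - y) z = edot x z - edot y z.
Proof. by rewrite edotDl edotNl. Qed.

Lemma edot_ge0 x : 0 <= edot x x.
Proof. by apply: sumr_ge0 => i _; rewrite -expr2 sqr_ge0. Qed.

Lemma enormE x : enorm x = Num.sqrt (edot x x).
Proof. by congr Num.sqrt; apply: eq_bigr => i _; rewrite expr2. Qed.

Lemma enorm_ge0 x : 0 <= enorm x. Proof. exact: sqrtr_ge0. Qed.

Lemma enorm_sqr x : enorm x ^+ 2 = edot x x.
Proof. by rewrite enormE sqr_sqrtr// edot_ge0. Qed.

Lemma enormZ a x : enorm (a *: x) = `|a| * enorm x.
Proof.
by rewrite !enormE edotZl edotZr mulrA -expr2 sqrtrM ?sqr_ge0// sqrtr_sqr.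
Qed.

Lemma enormN x : enorm (- x) = enorm x.
Proof. by rewrite -scaleN1r enormZ normrN1 mul1r. Qed.

Lemma enorm_distC x y : enorm (x - y) = enorm (y - x).
Proof. by rewrite -enormN opprB. Qed.

Lemma coord_enorm_le x i : `|x 0 i| <= enorm x.
Proof.
rewrite -(ler_pXn2r (n := 2)) ?nnegrE ?enorm_ge0// enorm_sqr real_normK ?num_real//.
rewrite /edot (bigD1 i)//= -expr2 lerDl.
by apply: sumr_ge0 => j _; rewrite -expr2 sqr_ge0.
Qed.

Lemma norm_le_enorm x : `|x| <= enorm x.
Proof.
rewrite /Num.Def.normr/= mx_normrE; apply/bigmax_leP; split=> [|[i j] _ /=].
  exact: enorm_ge0.
by rewrite (ord1 i) coord_enorm_le.
Qed.

Lemma enorm_le_norm x : enorm x <= n%:R * `|x|.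
Proof.
rewrite -(ler_pXn2r (n := 2)) ?nnegrE ?enorm_ge0 ?mulr_ge0// enorm_sqr.
have : edot x x <= n%:R * `|x| ^+ 2.
  rewrite mulr_natl -[X in _ *+ X](card_ord n) -sumr_const; apply: ler_sum => i _.
  by rewrite -expr2 -[leLHS]real_normK ?num_real// ler_pXn2r ?nnegrE// coord_norm_le.
move=> /le_trans; apply; rewrite exprMn ler_wpM2r ?sqr_ge0//.
by rewrite -natrX ler_nat; case: (n) => // k; rewrite expnS expn1 leq_pmulr.
Qed.

Lemma enorm_eq0 x : enorm x = 0 -> x = 0.
Proof.
move=> x0; apply/eqP; rewrite -normr_le0 -x0; exact: norm_le_enorm.
Qed.

Lemma cauchy_schwarz x y : edot x y <= enorm x * enorm y.
Proof.
have := enorm_ge0 x; rewrite le_eqVlt => /predU1P[/esym/enorm_eq0 ->|x0].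
  by rewrite /edot big1 ?mulr_ge0 ?enorm_ge0// => i _; rewrite mxE mul0r.
have := enorm_ge0 y; rewrite le_eqVlt => /predU1P[/esym/enorm_eq0 ->|y0].
  by rewrite /edot big1 ?mulr_ge0 ?enorm_ge0// => i _; rewrite mxE mulr0.
have := edot_ge0 (enorm y *: x - enorm x *: y).
rewrite !(edotBl, edotBr, edotZl, edotZr) -!enorm_sqr (edotC y x) => h.
have xy0 : 0 < enorm x * enorm y by rewrite mulr_gt0.
rewrite -(ler_pM2l xy0).
move: (enorm x) (enorm y) (edot x y) h => a b c; nra.
Qed.

Lemma enorm_triangle x y : enorm (x + y) <= enorm x + enorm y.
Proof.
rewrite -(ler_pXn2r (n := 2)) ?nnegrE ?addr_ge0 ?enorm_ge0// enorm_sqr.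
rewrite !(edotDl, edotDr) -!enorm_sqr (edotC y x) sqrrD.
have := cauchy_schwarz x y; lra.
Qed.

Lemma sum_abs_cauchy_schwarz (x y : 'rV[R]_n) :
  \sum_i `|x 0 i| * `|y 0 i| <= enorm x * enorm y.
Proof.
have absE (z : 'rV[R]_n) : enorm (map_mx Num.norm z) = enorm z :> R.
  rewrite !enormE; congr Num.sqrt; apply: eq_bigr => i _.
  by rewrite !mxE -!expr2 real_normK ?num_real.
rewrite -(absE x) -(absE y); have := cauchy_schwarz (map_mx Num.norm x) (map_mx Num.norm y).
by apply: le_trans; apply: ler_sum => i _; rewrite !mxE.
Qed.

Lemma enorm_lipschitz_continuous (f : 'rV[R]_n -> R) :
  (forall x y, `|f x - f y| <= enorm (x - y)) -> continuous f.
Proof.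
move=> lf x; apply/(@cvgrPdist_lt _ _ _ (nbhs x)) => e e0.
have N0 : 0 < n%:R + 1 :> R by rewrite ltr_wpDl.
apply/nbhs_ballP; exists (e / (n%:R + 1)) => /=; first by rewrite divr_gt0.
move=> y; rewrite -ball_normE/= ltr_pdivlMr// => xy.
apply: le_lt_trans xy; rewrite (le_trans (lf x y))//.
by rewrite (le_trans (enorm_le_norm _))// mulrC ler_wpM2l// lerDl.
Qed.

End euclidean_norm.

Section distance_to_complement.
Context {R : realType} {n : nat}.
Variable Omega : set 'rV[R]_n.
Hypotheses (oOmega : open Omega) (Omega_proper : ~` Omega !=set0).
Implicit Types (x y z e : 'rV[R]_n).

Definition cdist x : R := inf [set enorm (x - y) | y in ~` Omega].

Let has_inf_cdist x : has_inf [set enorm (x - y) | y in ~` Omega].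
Proof.
split; first by have [y Oy] := Omega_proper; exists (enorm (x - y)); exists y.
by exists 0 => _ [y _ <-]; exact: enorm_ge0.
Qed.

Lemma cdist_le x y : ~ Omega y -> cdist x <= enorm (x - y).
Proof. by move=> Oy; apply: ge_inf; [case: (has_inf_cdist x)|exists y]. Qed.

Lemma cdist_ge0 x : 0 <= cdist x.
Proof.
by apply: lb_le_inf; [case: (has_inf_cdist x)|move=> _ [y _ <-]; exact: enorm_ge0].
Qed.

Lemma cdist_lipschitz x y : cdist x <= cdist y + enorm (x - y).
Proof.
rewrite -lerBlDr; apply: lb_le_inf; first by case: (has_inf_cdist y).
move=> _ [z Oz <-]; rewrite lerBlDr (le_trans (cdist_le x Oz))//.
by rewrite [leRHS]addrC -(subrKA y) enorm_triangle.
Qed.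

Lemma cdist_out x : ~ Omega x -> cdist x = 0.
Proof.
move=> /(cdist_le x); rewrite subrr => h; apply/eqP; rewrite eq_le cdist_ge0 andbT.
by rewrite (le_trans h)// -(scale0r 0) enormZ normr0 mul0r.
Qed.

Lemma cdist_gt0 x : Omega x -> 0 < cdist x.
Proof.
move=> Ox; have /nbhs_ballP[r /= r0 rO] : nbhs x Omega by apply: open_nbhs_nbhs.
apply: (lt_le_trans r0); apply: lb_le_inf; first by case: (has_inf_cdist x).
move=> _ [y Oy <-]; rewrite leNgt; apply/negP => xyr; apply: Oy; apply: rO.
by rewrite -ball_normE/=; exact: le_lt_trans (norm_le_enorm _) xyr.
Qed.

Lemma cdist_gt0_in x : 0 < cdist x -> Omega x.
Proof. by apply: contraPP => /cdist_out ->; rewrite ltxx. Qed.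

Lemma cdist_ball x y : enorm (x - y) < cdist x -> Omega y.
Proof.
by apply: contraPP => /(cdist_le x); rewrite leNgt => /negP.
Qed.

Lemma continuous_cdist : continuous cdist.
Proof.
apply: enorm_lipschitz_continuous => x y.
have := cdist_lipschitz x y; have := cdist_lipschitz y x.
by rewrite (enorm_distC y x) ler_norml; lra.
Qed.

Lemma continuous_enormB x : continuous (fun y => enorm (x - y)).
Proof.
apply: enorm_lipschitz_continuous => y z; rewrite ler_norml.
have := enorm_triangle (x - z) (z - y); have := enorm_triangle (x - y) (y - z).
by rewrite !subrKA (enorm_distC z y); lra.
Qed.

Lemma nearest_point x : exists2 y, ~ Omega y & enorm (x - y) = cdist x.
Proof.
have [y0 Oy0] := Omega_proper.
pose K := ~` Omega `&` [set y | enorm (x - y) <= enorm (x - y0)].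
have Ky0 : K y0 by split => //=.
have cK : compact K.
  apply: bounded_closed_compact.
    exists (`|x| + enorm (x - y0)); split; first exact: num_real.
    move=> M hM y [_ /= xy]; apply: ltW; apply: le_lt_trans hM.
    rewrite -[y](subKr x) (le_trans (ler_normB _ _))// lerD2l.
    exact: le_trans (norm_le_enorm _) xy.
  apply: closedI; first exact: open_closedC.
  rewrite (_ : mkset _ = (fun y => enorm (x - y)) @^-1` [set t | t <= enorm (x - y0)])//.
  apply: closed_comp => [y _|]; first exact: continuous_enormB.
  exact: closed_le.
have cf : {within K, continuous (fun y => enorm (x - y))}.
  by apply: continuous_subspaceT; exact: continuous_enormB.
have [y /set_mem[Oy xy] ymin] := EVT_min_rV (ex_intro _ _ Ky0) cK cf.
exists y => //; apply/eqP; rewrite eq_le cdist_le// andbT.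
apply: lb_le_inf; first by case: (has_inf_cdist x).
move=> _ [z Oz <-]; have [xz|/ltW xz] := leP (enorm (x - z)) (enorm (x - y0)).
  by apply: ymin; apply: mem_set; split.
exact: le_trans xy xz.
Qed.

End distance_to_complement.

(** * Supergradients of the distance in a convex domain *)

Lemma convex_set_conv {R : realType} {V : lmodType R} (A : set V) (x y : V) (t : R) :
  @convex_set R V A -> A x -> A y -> 0 <= t <= 1 -> A (t *: x + (1 - t) *: y).
Proof.
move=> cA Ax Ay /andP[t0 t1].
by have := cA x y (Itv01 t0 t1) (mem_set Ax) (mem_set Ay); rewrite inE.
Qed.

Section convex_distance.
Context {R : realType} {n : nat}.
Variable Omega : set 'rV[R]_n.
Hypotheses (oOmega : open Omega) (Omega_proper : ~` Omega !=set0).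
Hypothesis cOmega : @convex_set R 'rV[R]_n Omega.
Implicit Types (x y z e : 'rV[R]_n).

(** Let [y] be a nearest point of the complement and [e] the unit vector from
    [y] to [x].  If a point of [Omega] lay beyond the hyperplane through [y]
    orthogonal to [e], then [y] would be a convex combination of it and of a
    point of the ball around [x], hence in [Omega].  So the hyperplane bounds
    [Omega], and the distance to it bounds the distance to the complement. *)
Lemma cdist_supergradient x : Omega x -> exists2 e, edot e e = 1 &
  forall z, Omega z -> cdist Omega z <= cdist Omega x + edot e (z - x).
Proof.
move=> Ox; have [y Oy xy] := nearest_point oOmega Omega_proper x.
have d0 := cdist_gt0 oOmega Omega_proper Ox.
set d := cdist Omega x in xy d0 *.
have dN0 : d != 0 by rewrite gt_eqF.
pose e := d^-1 *: (x - y).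
have ee : edot e e = 1.
  rewrite edotZl edotZr -enorm_sqr xy; field; done.
have xE : x - y = d *: e by rewrite scalerA mulfV// scale1r.
clearbody e; exists e => // z Oz.
have -> : d + edot e (z - x) = edot e (z - y).
  have -> : edot e (z - y) = edot e (z - x) + edot e (x - y).
    by rewrite -edotDr subrKA.
  by rewrite xE edotZr ee mulr1 addrC.
have half w : Omega w -> 0 <= edot e (w - y).
  move=> Ow; rewrite leNgt; apply/negP => ewy; apply: Oy.
  pose v := y - w; have ev : 0 < edot e v by rewrite /v -opprB edotNr oppr_gt0.
  have vE : w = y - v by rewrite opprB addrC subrK.
  clearbody v; have vv : 0 < edot v v + 1 by rewrite ltr_wpDl// edot_ge0.
  (* Small enough for y + t *: v to lie in the ball of radius d around x. *)
  pose t := d * edot e v / (edot v v + 1).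
  have t0 : 0 < t by rewrite divr_gt0// mulr_gt0.
  have Ozt : Omega (y + t *: v).
    apply: (cdist_ball Omega_proper (x := x)); rewrite -/d.
    rewrite opprD addrA xE -(ltr_pXn2r (n := 2)) ?nnegrE ?enorm_ge0 ?ltW//.
    rewrite enorm_sqr !(edotBl, edotBr, edotZl, edotZr) ee (edotC v e).
    suff : t * edot v v < 2 * d * edot e v by nra.
    rewrite /t mulrAC ltr_pdivrMr// -subr_gt0.
    have := edot_ge0 v; have : 0 < d * edot e v by rewrite mulr_gt0.
    move: (edot v v) (edot e v) => p q; nra.
  have -> : y = (1 + t)^-1 *: (y + t *: v) + (1 - (1 + t)^-1) *: w.
    have t1 : 1 + t != 0 by rewrite gt_eqF// ltr_wpDr// ltW.
    apply: (scalerI t1); rewrite scalerDr !scalerA mulfV// mulrBr mulr1 mulfV//.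
    rewrite scale1r (_ : 1 + t - 1 = t); last by ring.
    by rewrite vE scalerBr scalerDl scale1r addrACA subrr addr0.
  have t1 : 1 <= 1 + t by rewrite lerDl ltW.
  apply: convex_set_conv => //.
  by rewrite invr_ge0 (le_trans _ t1)//= invf_le1// (lt_le_trans _ t1).
rewrite leNgt; apply/negP => h.
have ez := half _ Oz.
(* Moving from z against e by an amount between the distance to the hyperplane
   and the distance to the complement stays in Omega and crosses. *)
pose s := (cdist Omega z + edot e (z - y)) / 2.
have Ozs : Omega (z - s *: e).
  apply: (cdist_ball Omega_proper (x := z)); rewrite opprB addrCA subrr addr0 enormZ.
  rewrite enormE ee sqrtr1 mulr1 ger0_norm /s; last by rewrite divr_ge0// addr_ge0// cdist_ge0.
  by lra.
have := half _ Ozs; rewrite addrAC edotBr edotZr ee mulr1 /s; lra.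
Qed.

(** A nearest point of the complement lies on the boundary: the open segment
    towards it is nearer to [x], hence inside [Omega]. *)
Lemma dist_boundaryE x : Omega x -> dist_boundary Omega x = (cdist Omega x)%:E.
Proof.
move=> Ox; have [y Oy xy] := nearest_point oOmega Omega_proper x.
have d0 := cdist_gt0 oOmega Omega_proper Ox.
have bE : boundary Omega = closure Omega `\` Omega.
  by rewrite /boundary ((interior_id Omega).1 oOmega).
apply/eqP; rewrite eq_le; apply/andP; split; last first.
  apply: le_ereal_inf_tmp => _ [z + <-]; rewrite bE => -[_ Oz].
  by rewrite lee_fin cdist_le.
apply: ereal_inf_lbound; exists y; last by rewrite xy.
rewrite bE; split => // B /nbhs_ballP[r /= r0 rB].
pose t := Num.min (2^-1) (r / (2 * cdist Omega x)).
have t0 : 0 < t by rewrite lt_min invr_gt0 ltr0n/= divr_gt0// mulr_gt0.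
have t1 : t < 1 by rewrite gt_min; apply/orP; left; lra.
exists (y + t *: (x - y)); split.
  apply: (cdist_ball Omega_proper (x := x)).
  rewrite (_ : x - (y + t *: (x - y)) = (1 - t) *: (x - y)); last first.
    by rewrite opprD addrA scalerBl scale1r.
  by rewrite enormZ xy gtr0_norm ?subr_gt0// gtr_pMl// gtrBl.
apply: rB; rewrite -ball_normE/= opprD addrA subrr sub0r normrN.
apply: (le_lt_trans (norm_le_enorm _)); rewrite enormZ xy gtr0_norm//.
have tr : t <= r / (2 * cdist Omega x) by rewrite ge_min lexx orbT.
apply: (@le_lt_trans _ _ (r / 2)); last by lra.
move: tr; rewrite ler_pdivlMr ?mulr_gt0//; lra.
Qed.

Lemma cdist_le_inradius x : (inradius Omega < +oo)%E -> Omega x ->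
  cdist Omega x <= fine (inradius Omega).
Proof.
move=> ioo Ox; have h : ((cdist Omega x)%:E <= inradius Omega)%E.
  by apply: ereal_sup_ubound; exists x => //; exact: dist_boundaryE.
have i0 : (0 <= inradius Omega)%E.
  by apply: le_trans h; rewrite lee_fin cdist_ge0.
by rewrite -lee_fin fineK// ge0_fin_numE.
Qed.

End convex_distance.

Lemma inradius_proper {R : realType} {n : nat} (Omega : set 'rV[R]_n) :
  Omega !=set0 -> (inradius Omega < +oo)%E -> ~` Omega !=set0.
Proof.
move=> [x Ox] ioo; apply/set0P/eqP => Oc; move: ioo.
have OT : Omega = setT by rewrite -(setCK Omega) Oc setC0.
suff : (+oo <= inradius Omega)%E by move=> /le_lt_trans h /h; rewrite ltxx.
apply: ereal_sup_ubound; exists x => //.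
rewrite /dist_boundary /boundary OT interiorT setDT image_set0.
exact: ereal_inf0.
Qed.

(** * Calculus of a profile *)

Section profile_calculus.
Context {R : realType}.
Variables (b : R) (w Psi phi : R -> R).
Implicit Types s t a k : R.
Hypothesis Psi_derive : forall t, 0 < t < b -> is_derive t 1 Psi (phi t).
Hypothesis phi_derivable : forall t, 0 < t < b -> derivable phi t 1.
Hypothesis phi'_le : forall t, 0 < t < b -> derive1 phi t <= - w t.
Hypothesis phi_ge0 : forall t, 0 < t < b -> 0 <= phi t.
Hypothesis w_ge0 : forall t, 0 < t < b -> 0 <= w t.

Lemma phi_mean_value s t : 0 < s -> s < t -> t < b ->
  exists2 c, s <= c <= t & phi t - phi s = derive1 phi c * (t - s).
Proof.
move=> s0 st tb.
have dphi x : 0 < x < b -> is_derive x 1 phi (derive1 phi x).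
  by move=> /phi_derivable d; rewrite derive1E; exact: derivableP.
have [x|x /=|c] := @MVT _ phi (derive1 phi) _ _ st.
- rewrite in_itv/= => /andP[sx xt]; apply: dphi.
  by rewrite (lt_trans s0 sx) (lt_trans xt tb).
- apply/subspace_continuousP: x => x /=; rewrite in_itv/= => /andP[sx xt].
  apply: cvg_within_filter; apply: is_derive_continuous (dphi x _).
  by rewrite (lt_le_trans s0 sx) (le_lt_trans xt tb).
- rewrite in_itv/= => /andP[sc ct] E; exists c => //.
  by rewrite !ltW.
Qed.

Lemma phi_nincr s t : 0 < s -> s <= t -> t < b -> phi t <= phi s.
Proof.
move=> s0; rewrite le_eqVlt => /predU1P[->//|st] tb.
have [c /andP[sc ct] E] := phi_mean_value s0 st tb.
have cb : 0 < c < b by rewrite (lt_le_trans s0 sc) (le_lt_trans ct tb).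
rewrite -subr_le0 E mulr_le0_ge0 ?subr_ge0 ?(ltW st)//.
by rewrite (le_trans (phi'_le cb))// oppr_le0 w_ge0.
Qed.

Lemma Psi_mean_value s t : 0 < s -> s < t -> t < b ->
  exists2 c, s <= c <= t & Psi t - Psi s = phi c * (t - s).
Proof.
move=> s0 st tb.
have [x|x /=|c] := @MVT _ Psi phi _ _ st.
- rewrite in_itv/= => /andP[sx xt]; apply: Psi_derive.
  by rewrite (lt_trans s0 sx) (lt_trans xt tb).
- apply/subspace_continuousP: x => x /=; rewrite in_itv/= => /andP[sx xt].
  apply: cvg_within_filter; apply: is_derive_continuous (Psi_derive _).
  by rewrite (lt_le_trans s0 sx) (le_lt_trans xt tb).
- rewrite in_itv/= => /andP[sc ct] E; exists c => //.
  by rewrite !ltW.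
Qed.

Lemma Psi_ndecr s t : 0 < s -> s <= t -> t < b -> Psi s <= Psi t.
Proof.
move=> s0; rewrite le_eqVlt => /predU1P[->//|st] tb.
have [c /andP[sc ct] E] := Psi_mean_value s0 st tb.
have cb : 0 < c < b by rewrite (lt_le_trans s0 sc) (le_lt_trans ct tb).
by rewrite -subr_ge0 E mulr_ge0 ?phi_ge0// subr_ge0 ltW.
Qed.

Lemma Psi_tangent s t : 0 < s < b -> 0 < t < b ->
  Psi t <= Psi s + phi s * (t - s).
Proof.
move=> /andP[s0 sb] /andP[t0 tb]; rewrite -lerBlDl.
have [st|ts|->] := ltgtP s t; last by rewrite !subrr mulr0.
- have [c /andP[sc ct] ->] := Psi_mean_value s0 st tb.
  rewrite ler_wpM2r ?subr_ge0 ?(ltW st)//; apply: phi_nincr => //.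
  exact: le_lt_trans ct tb.
- have [c /andP[sc ct] E] := Psi_mean_value t0 ts sb.
  rewrite -lerN2 opprB E -mulrN opprB ler_wpM2r ?subr_ge0 ?(ltW ts)//.
  by apply: phi_nincr => //; exact: lt_le_trans t0 sc.
Qed.

(** As a function of [s] the difference of the two sides vanishes at [0] and has
    derivative [phi (a - s) - phi (a + s) - 2 * k * s], which is nonnegative by
    the mean value theorem for [phi]. *)
Lemma Psi_second_difference a s k : `|s| < a -> a + `|s| < b ->
  (forall t, `|t - a| <= `|s| -> k <= w t) ->
  k * s ^+ 2 <= 2 * Psi a - Psi (a + s) - Psi (a - s).
Proof.
wlog s0 : s / 0 <= s.
  move=> H sa sb kw; have [|s0] := leP 0 s; first by move=> s0; exact: H.
  have := H (- s); rewrite oppr_ge0 normrN sqrrN opprK => /(_ (ltW s0) sa sb kw).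
  by rewrite addrAC.
rewrite (ger0_norm s0) => sa sb kw.
move: s0; rewrite le_eqVlt => /predU1P[<-|s0].
  by rewrite expr0n/= mulr0 addr0 subr0; lra.
pose G r := 2 * Psi a - Psi (a + r) - Psi (a - r) - k * r ^+ 2.
have dG r : 0 <= r <= s -> is_derive r 1 G (phi (a - r) - phi (a + r) - 2 * k * r).
  move=> /andP[r0 rs].
  have e1 : is_derive r 1 (fun r => a + r) 1.
    exact: (is_derive_eq (is_deriveD (is_derive_cst a r 1) (is_derive_id r 1)) (add0r 1)).
  have e2 : is_derive r 1 (fun r => a - r) (-1).
    exact: (is_derive_eq (is_deriveB (is_derive_cst a r 1) (is_derive_id r 1)) (sub0r 1)).
  have d1 : is_derive (a + r) 1 Psi (phi (a + r)) by apply: Psi_derive; lra.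
  have d2 : is_derive (a - r) 1 Psi (phi (a - r)) by apply: Psi_derive; lra.
  have f1 := is_derive1_comp (f := Psi) (g := fun r => a + r) d1 e1.
  have f2 := is_derive1_comp (f := Psi) (g := fun r => a - r) d2 e2.
  have f3 : is_derive r 1 (fun r : R => k * r ^+ 2) (2 * k * r).
    by apply: is_derive_eq; rewrite /GRing.scale/=; ring.
  apply: (is_derive_eq (is_deriveB (is_deriveB
    (is_deriveB (is_derive_cst (2 * Psi a) r 1) f1) f2) f3)).
  by ring.
have [x|x /=|c] := @MVT _ G (fun r => phi (a - r) - phi (a + r) - 2 * k * r) _ _ s0.
- by rewrite in_itv/= => /andP[sx xt]; apply: dG; rewrite !ltW.
- apply/subspace_continuousP: x => x /=; rewrite in_itv/= => xs.
  by apply: cvg_within_filter; apply: is_derive_continuous (dG x _).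
rewrite in_itv/= => /andP[c0 cs].
have -> : G 0 = 0 by rewrite /G addr0 subr0 expr0n/= mulr0; ring.
rewrite !subr0 => GE.
suff : 0 <= G s by rewrite /G; lra.
rewrite GE mulr_ge0 ?(ltW s0)// subr_ge0.
have [||| y /andP[y1 y2] E] := @phi_mean_value (a - c) (a + c); [lra..|].
have /phi'_le p1 : 0 < y < b by lra.
have kwy : k <= w y by apply: kw; rewrite ler_norml; lra.
have -> : phi (a - c) - phi (a + c) = - derive1 phi y * (2 * c).
  by rewrite -opprB E; ring.
have -> : 2 * k * c = k * (2 * c) by ring.
by rewrite ler_pM2r ?mulr_gt0//; lra.
Qed.

(** * The potential, its increments and its second differences *)

Section superharmonic.
Context {n : nat}.
Variables (Omega : set 'rV[R]_n) (D : R).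
Hypotheses (oOmega : open Omega) (Omega_proper : ~` Omega !=set0).
Hypothesis cOmega : @convex_set R 'rV[R]_n Omega.
Hypotheses (cdist_le_D : forall x, Omega x -> cdist Omega x <= D) (Db : D < b).
Implicit Types (x y z v e : 'rV[R]_n) (h : R) (i : 'I_n).
Local Notation d := (cdist Omega).

(** Set to [0] outside [Omega], where the distance vanishes and [Psi] has no
    meaning, so that the function is measurable. *)
Definition potential := (Psi \o d) \_ Omega.

Lemma potentialE x : Omega x -> potential x = Psi (d x).
Proof. by move=> Ox; rewrite /potential patchE mem_set. Qed.

Lemma cdist_in_profile x : Omega x -> 0 < d x < b.
Proof.
by move=> Ox; rewrite (cdist_gt0 oOmega Omega_proper Ox)/= (le_lt_trans (cdist_le_D Ox)).
Qed.

Definition supergradient x e := edot e e = 1 /\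
  forall z, Omega z -> d z <= d x + edot e (z - x).

Lemma supergradient_ex x : Omega x -> exists e, supergradient x e.
Proof.
move=> /(cdist_supergradient oOmega Omega_proper cOmega)[e ee es].
by exists e.
Qed.

Lemma edot_unit_le e v : edot e e = 1 -> `|edot e v| <= enorm v.
Proof.
move=> ee; have e1 : enorm e = 1 by rewrite enormE ee sqrtr1.
have := cauchy_schwarz e v; have := cauchy_schwarz (- e) v.
by rewrite enormN edotNl e1 !mul1r ler_norml; lra.
Qed.

Lemma potential_le_affine x v e : Omega x -> Omega (x + v) -> supergradient x e ->
  enorm v < b - D -> 0 < d x + edot e v < b /\
  potential (x + v) <= Psi (d x + edot e v).
Proof.
move=> Ox Ov [ee es] vb; have := es _ Ov; rewrite addrAC subrr add0r => dv.
have := edot_unit_le v ee; rewrite ler_norml => /andP[_ ev].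
have /andP[d0 _] := cdist_in_profile Ov.
have db : d x + edot e v < b by have := cdist_le_D Ox; lra.
have d1 : 0 < d x + edot e v by lra.
by split; [rewrite d1 db|rewrite potentialE// Psi_ndecr].
Qed.

Lemma potential_tangent x v e : Omega x -> Omega (x + v) -> supergradient x e ->
  enorm v < b - D -> potential (x + v) - potential x <= phi (d x) * edot e v.
Proof.
move=> Ox Ov se vb; have [db] := potential_le_affine Ox Ov se vb.
have := Psi_tangent (cdist_in_profile Ox) db.
by rewrite (potentialE Ox) addrAC subrr add0r; lra.
Qed.

(** A supergradient has slope at most [phi eps] where the distance is at least
    [eps]; apply the tangent bound at both ends. *)
Lemma potential_lipschitz x y eps : 0 < eps -> eps <= d x -> eps <= d y ->
  enorm (y - x) < b - D ->
  `|potential y - potential x| <= phi eps * enorm (y - x).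
Proof.
move=> e0 ex ey.
have Ox : Omega x by apply: (cdist_gt0_in Omega_proper); exact: lt_le_trans ex.
have Oy : Omega y by apply: (cdist_gt0_in Omega_proper); exact: lt_le_trans ey.
have main u v : Omega u -> Omega v -> eps <= d u -> enorm (v - u) < b - D ->
    potential v - potential u <= phi eps * enorm (v - u).
  move=> Ou Ov eu uv; have [e se] := supergradient_ex Ou.
  have := @potential_tangent u (v - u) e Ou; rewrite subrKC => /(_ Ov se uv).
  move=> /le_trans; apply; have := edot_unit_le (v - u) se.1.
  rewrite ler_norml => /andP[_ ev]; have /andP[du0 dub] := cdist_in_profile Ou.
  apply: (@le_trans _ _ (phi (d u) * enorm (v - u))).
    by rewrite ler_wpM2l// phi_ge0// du0.
  by rewrite ler_wpM2r ?enorm_ge0//; exact: phi_nincr.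
move=> xy; have := main x y Ox Oy ex xy.
have := main y x Oy Ox ey; rewrite enorm_distC => /(_ xy).
by rewrite ler_norml; lra.
Qed.

Lemma potential_second_difference x v e k : Omega x -> Omega (x + v) ->
  Omega (x - v) -> supergradient x e -> enorm v < b - D -> enorm v < d x ->
  (forall t, `|t - d x| <= enorm v -> k <= w t) ->
  k * edot e v ^+ 2 <= 2 * potential x - potential (x + v) - potential (x - v).
Proof.
move=> Ox Ov Omv se vb vd kw.
have [_ h1] := potential_le_affine Ox Ov se vb.
have [_] := potential_le_affine Ox Omv se (eq_ind_r (fun t => t < b - D) vb (enormN v)).
rewrite edotNr (potentialE Ox) => h2.
have ev := edot_unit_le v se.1.
have := @Psi_second_difference (d x) (edot e v) k.
have h3 : `|edot e v| < d x by exact: le_lt_trans ev vd.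
have h4 : d x + `|edot e v| < b by have := cdist_le_D Ox; lra.
move=> /(_ h3 h4); have h5 t : `|t - d x| <= `|edot e v| -> k <= w t.
  by move=> th; apply: kw; exact: le_trans th ev.
by move=> /(_ h5); lra.
Qed.

Definition step h i : 'rV[R]_n := h *: delta_mx 0 i.

Lemma edot_step e h i : edot e (step h i) = h * e 0 i.
Proof.
rewrite edotZr /edot (bigD1 i)//= mxE !eqxx mulr1 big1 ?addr0// => j ji.
by rewrite mxE (negbTE ji) andbF mulr0.
Qed.

Lemma enorm_step h i : 0 <= h -> enorm (step h i) = h.
Proof.
move=> h0; rewrite enormZ ger0_norm// enormE.
rewrite -[X in edot _ X]scale1r -/(step 1 i) edot_step mul1r mxE !eqxx.
by rewrite sqrtr1 mulr1.
Qed.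

Definition second_difference h i x :=
  2 * potential x - potential (x + step h i) - potential (x - step h i).

Definition small_step eps h := [/\ 0 < eps, 0 < h, h <= eps & h < b - D].

Lemma cdist_step eps h x i a : small_step eps h -> a + eps <= d x ->
  a <= d (x + step h i) /\ a <= d (x - step h i).
Proof.
move=> [eps0 h0 heps hb] ax; have := cdist_lipschitz Omega_proper x (x + step h i).
have := cdist_lipschitz Omega_proper x (x - step h i).
have -> : x - (x + step h i) = - step h i by rewrite opprD addrA subrr sub0r.
rewrite subKr enormN enorm_step ?(ltW h0)// => h1 h2.
have le_a y : d x <= d y + h -> a <= d y.
  by move=> xy; rewrite -(lerD2r eps) (le_trans ax)// (le_trans xy)// lerD2l.
by split; apply: le_a.
Qed.

Lemma step_in eps h x i : small_step eps h -> eps + eps <= d x ->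
  [/\ Omega x, Omega (x + step h i) & Omega (x - step h i)].
Proof.
move=> sh ex; have [e1 e2] := cdist_step i sh ex; have [eps0 h0 heps hb] := sh.
by split; apply: (cdist_gt0_in Omega_proper); lra.
Qed.

Lemma second_difference_ge0 eps h x i : small_step eps h -> eps + eps <= d x ->
  0 <= second_difference h i x.
Proof.
move=> sh ex; have [eps0 h0 heps hb] := sh.
have [Ox Ov Omv] := step_in i sh ex; have [e se] := supergradient_ex Ox.
have en : enorm (step h i) = h by rewrite enorm_step// ltW.
have := @potential_second_difference x (step h i) e 0 Ox Ov Omv se.
rewrite en mul0r; apply => //; first by lra.
move=> t; rewrite ler_norml => th; apply: w_ge0.
by have := cdist_le_D Ox; lra.
Qed.

(** The same supergradient [e] serves all directions, and the squares of its
    coordinates add up to [1]. *)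
Lemma sum_second_difference eps h x k : small_step eps h -> eps + eps <= d x ->
  (forall t, `|t - d x| <= h -> k <= w t) ->
  k * h ^+ 2 <= \sum_(i < n) second_difference h i x.
Proof.
move=> sh ex kw; have [eps0 h0 heps hb] := sh.
have Ox : Omega x by apply: (cdist_gt0_in Omega_proper); lra.
have [e se] := supergradient_ex Ox.
have -> : k * h ^+ 2 = \sum_(i < n) k * edot e (step h i) ^+ 2.
  under eq_bigr do rewrite edot_step exprMn mulrA (expr2 (e 0 _)).
  by rewrite -mulr_sumr -/(edot e e) se.1 mulr1.
apply: ler_sum => i _; have [_ Ov Omv] := step_in i sh ex.
have en : enorm (step h i) = h by rewrite enorm_step// ltW.
by apply: potential_second_difference; rewrite ?en//; lra.
Qed.

(** The increment is pinched between the linear prediction of a supergradient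
    and the same prediction minus the second difference; this plays the part of
    almost everywhere differentiability of the distance. *)
Lemma potential_increment eps h x e i : small_step eps h ->
  eps + eps <= d x -> supergradient x e ->
  h * (phi (d x) * e 0 i) - second_difference h i x <=
    potential (x + step h i) - potential x <= h * (phi (d x) * e 0 i).
Proof.
move=> sh ex se; have [eps0 h0 heps hb] := sh; have [Ox Ov Omv] := step_in i sh ex.
have en : enorm (step h i) < b - D by rewrite enorm_step// ltW.
have enN : enorm (- step h i) < b - D by rewrite enormN.
have := potential_tangent Ox Ov se en; have := potential_tangent Ox Omv se enN.
by rewrite edotNr edot_step /second_difference; lra.
Qed.

(** * Compactly supported functions and the energy estimate *)

Section compactly_supported.
Variable f : 'rV[R]_n -> R.
Hypothesis fC1 : C1_compact_support Omega f.
Local Notation K := (closure (Omega `&` [set x | f x != 0])).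

Lemma f_out x : Omega x -> ~ K x -> f x = 0.
Proof.
move=> Ox; apply: contra_notP => /eqP fx.
exact: subset_closure.
Qed.

Lemma gradient_out x : Omega x -> ~ K x -> gradient f x = 0.
Proof.
move=> Ox Kx; apply/rowP => i; rewrite !mxE.
rewrite (@near_eq_derive _ _ _ _ (cst 0)) ?derive_cst//.
have oU : open (Omega `&` ~` K) by apply: openI => //; exact/closed_openC/closed_closure.
have : nbhs x (Omega `&` ~` K) by apply: open_nbhs_nbhs.
by apply: filterS => y [Oy Ky]; exact: f_out.
Qed.

Lemma f_continuous x : Omega x -> {for x, continuous f}.
Proof. by move=> Ox; have [df _ _ _] := fC1; exact/differentiable_continuous/df. Qed.

Lemma enorm_gradient_continuous x : Omega x ->
  {for x, continuous (fun y => enorm (gradient f y))}.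
Proof.
move=> Ox; have [_ cg _ _] := fC1.
apply: (@continuous_comp _ _ _ (gradient f) (@enorm R n)); first exact: cg.
apply: enorm_lipschitz_continuous => y z; rewrite ler_norml.
have := enorm_triangle (y - z) z; have := enorm_triangle (z - y) y.
by rewrite !subrK (enorm_distC z y); lra.
Qed.

(** The difference quotients of the two sides are the same functions. *)
Lemma is_derive_line x i s : Omega (x + step s i) ->
  is_derive s 1 (fun s => f (x + step s i)) (gradient f (x + step s i) 0 i).
Proof.
move=> Oxs; have [df _ _ _] := fC1.
have E : (fun h => h^-1 *: (f (x + step (h *: 1 + s) i) - f (x + step s i))) =
    (fun h => h^-1 *: (f (h *: delta_mx 0 i + (x + step s i)) - f (x + step s i))).
  apply/funext => h; congr (_ *: (f _ - _)).
  by rewrite /step scalerDl [h *: 1]mulr1 addrCA.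
have dv : derivable f (x + step s i) (delta_mx 0 i) by apply/diff_derivable/df.
split; first by rewrite /derivable E.
by rewrite mxE /derive E.
Qed.

Lemma f_increment eps h x i eta : small_step eps h -> eps + eps <= d x ->
  (forall y, `|x - y| <= h -> `|gradient f x 0 i - gradient f y 0 i| <= eta) ->
  `|f (x + step h i) - f x| <= h * (`|gradient f x 0 i| + eta).
Proof.
move=> sh ex geta; have [eps0 h0 heps hb] := sh.
have Oxs s : 0 <= s <= h -> Omega (x + step s i).
  move=> /andP[]; rewrite le_eqVlt => /predU1P[<- _|s0 hs].
    by rewrite /step scale0r addr0; have [] := step_in i sh ex.
  have ss : small_step eps s by split => //; lra.
  by have [] := step_in i ss ex.
have [s|s /=|s] := @MVT _ (fun s => f (x + step s i))
    (fun s => gradient f (x + step s i) 0 i) _ _ h0.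
- by rewrite in_itv/= => /andP[s0 sh']; apply/is_derive_line/Oxs; rewrite !ltW.
- apply/subspace_continuousP: s => s /=; rewrite in_itv/= => sh'.
  by apply: cvg_within_filter; apply: is_derive_continuous (is_derive_line (Oxs s _)).
rewrite in_itv/= => /andP[s0 sh']; rewrite {2}/step scale0r addr0 subr0 => ->.
rewrite normrM (gtr0_norm h0) mulrC ler_pM2l//.
have := geta (x + step s i); rewrite opprD addrA subrr sub0r normrN => gs.
have {}gs : `|gradient f x 0 i - gradient f (x + step s i) 0 i| <= eta.
  by apply: gs; apply: le_trans (norm_le_enorm _) _; rewrite enorm_step; lra.
have := ler_normD (gradient f x 0 i) (gradient f (x + step s i) 0 i - gradient f x 0 i).
by rewrite subrKC distrC; lra.
Qed.

Lemma support_margin : 0 < b -> exists eps M, [/\ 0 < eps < b,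
  forall x, K x -> 4 * eps <= d x & forall x, K x -> `|x| <= M].
Proof.
move=> b0; have [_ _ cK KO] := fC1.
have [M [_ KM]] := compact_bounded cK.
have KM' x : K x -> `|x| <= M + 1 by move=> Kx; apply: KM => //; rewrite ltrDl.
suff [m m0 mK] : exists2 m, 0 < m & forall x, K x -> m <= d x.
  exists (Num.min (m / 4) (b / 2)), (M + 1); split => //.
    rewrite lt_min !divr_gt0//= gt_min; apply/orP; right; lra.
  move=> x /mK; apply: le_trans.
  by rewrite mulrC -ler_pdivlMr// ge_min lexx.
have [K0|/set0P[x0 Kx0]] := eqVneq K set0.
  by exists 1 => // x; rewrite K0.
have cd : {within K, continuous d}.
  by apply: continuous_subspaceT; exact: continuous_cdist.
have [x /set_mem Kx xmin] := EVT_min_rV (ex_intro _ _ Kx0) cK cd.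
exists (d x); first by apply: (cdist_gt0 oOmega) => //; exact: KO.
by move=> y Ky; apply: xmin; exact: mem_set.
Qed.

Hypothesis w_continuous : forall t, 0 < t < b -> {for t, continuous w}.

Lemma continuous_profile_cdist (g : R -> R) x :
  (forall t, 0 < t < b -> {for t, continuous g}) -> Omega x ->
  {for x, continuous (fun y => g (d y))}.
Proof.
move=> cg Ox; apply: (@continuous_comp _ _ _ d g).
  exact: continuous_cdist.
by apply: cg; exact: cdist_in_profile.
Qed.

Lemma tame_gradient_weight (g : R -> R) :
  (forall t, 0 < t < b -> {for t, continuous g}) ->
  tame ((fun x => g (d x) * enorm (gradient f x)) \_ Omega).
Proof.
move=> cg; have [_ _ cK KO] := fC1.
apply: (tame_patch (K := K)) => // x Ox.
  by apply: continuousM; [exact: continuous_profile_cdist|exact: enorm_gradient_continuous].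
by move=> /(gradient_out Ox) ->; rewrite -(scale0r 0) enormZ normr0 mul0r mulr0.
Qed.

Lemma tame_weight (g : R -> R) :
  (forall t, 0 < t < b -> {for t, continuous g}) ->
  tame ((fun x => `|f x| * g (d x)) \_ Omega).
Proof.
move=> cg; have [_ _ cK KO] := fC1.
apply: (tame_patch (K := K)) => // x Ox.
  apply: continuousM; last exact: continuous_profile_cdist.
  apply: (@continuous_comp _ _ _ f (fun t : R => `|t|)); first exact: f_continuous.
  exact: norm_continuous.
by move=> /(f_out Ox) ->; rewrite normr0 mul0r.
Qed.

Local Notation I g := (\int[lebesgue_rV]_x g x).

Let u x := `|(f \_ Omega) x|.

Let u_supp x : u x != 0 -> Omega x /\ K x.
Proof.
rewrite /u normr_eq0 patchE; case: ifPn => [/set_mem Ox fx|_]; last by rewrite eqxx.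
by split => //; exact: subset_closure.
Qed.

Let tame_f : tame (f \_ Omega).
Proof.
have [_ _ cK KO] := fC1; apply: (tame_patch (K := K)) => // x Ox.
  exact: f_continuous.
exact: f_out.
Qed.

Let tame_u : tame u.
Proof.
have [mf _ _] := tame_f; apply: (tame_le (c := 1) tame_f).
  exact: measurableT_comp.
by move=> x; rewrite /u normr_id mul1r.
Qed.

Let measurable_potential : measurable_fun setT potential.
Proof.
apply: (measurable_restrictT (Psi \o d) (measurable_open_rV oOmega)).1.
apply: measurable_continuous_rV => // x Ox.
by apply: continuous_profile_cdist => // t tb; exact: is_derive_continuous (Psi_derive tb).
Qed.

(** The increment itself may be large outside the support of [g]. *)
Let tame_increment (g : 'rV[R]_n -> R) v c : tame g ->
  (forall x, g x != 0 -> `|potential x - potential (x + v)| <= c) ->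
  tame (fun x => g x * (potential x - potential (x + v))).
Proof.
move=> tg gc; have [mg _ _] := tg; apply: (tame_le (c := `|c|) tg).
  apply: measurable_funM => //; apply: measurable_funB => //.
  exact: (measurableT_comp measurable_potential (measurable_rV_shift v)).
move=> x; rewrite normrM mulrC; have [->|gx] := eqVneq (g x) 0.
  by rewrite normr0 !mulr0.
by rewrite ler_wpM2r// (le_trans (gc _ gx))// ler_norm.
Qed.

Section cutoff.
Variables (eps M : R).
Hypotheses (eps0 : 0 < eps) (epsb : eps < b) (Keps : forall x, K x -> 4 * eps <= d x)
  (KM : forall x, K x -> `|x| <= M).

(** A Lipschitz function that is at least [eps] near the support of [f] and
    vanishes near the boundary and far away; dividing it by [eps] bounds the
    indicator function of the relevant points from above. *)
Definition cutoff x := Num.max 0 (Num.min (d x - 2 * eps) (M + 2 * eps - `|x|)).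

Definition cutoff_supp := [set x | 2 * eps <= d x /\ `|x| <= M + 2 * eps].

Lemma cutoff_ge0 x : 0 <= cutoff x.
Proof. by rewrite le_max lexx. Qed.

Lemma cutoff_neq0 x : cutoff x != 0 -> cutoff_supp x.
Proof.
move=> cx; have : 0 < cutoff x by rewrite lt_neqAle eq_sym cx cutoff_ge0.
by rewrite lt_max ltxx/= lt_min !subr_gt0 => /andP[/ltW ? /ltW ?].
Qed.

Lemma cutoff_ge x : 3 * eps <= d x -> `|x| <= M + eps -> eps <= cutoff x.
Proof.
by move=> dx xM; rewrite le_max; apply/orP; right; rewrite le_min; lra.
Qed.

Lemma cutoff_lipschitz x y : `|cutoff x - cutoff y| <= enorm (x - y).
Proof.
have main p z : cutoff p <= cutoff z + enorm (p - z).
  rewrite /cutoff ge_max; apply/andP; split.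
    by rewrite addr_ge0 ?cutoff_ge0 ?enorm_ge0.
  apply: (@le_trans _ _ (Num.min (d z - 2 * eps) (M + 2 * eps - `|z|) + enorm (p - z))).
    rewrite -lerBlDr le_min; apply/andP; split.
      have := cdist_lipschitz Omega_proper p z.
      have : Num.min (d p - 2 * eps) (M + 2 * eps - `|p|) <= d p - 2 * eps.
        by rewrite ge_min lexx.
      lra.
    have : `|z| <= `|p| + enorm (p - z).
      rewrite -[z](subKr p) (le_trans (ler_normB _ _))// lerD2l subKr.
      exact: norm_le_enorm.
    have : Num.min (d p - 2 * eps) (M + 2 * eps - `|p|) <= M + 2 * eps - `|p|.
      by rewrite ge_min lexx orbT.
    lra.
  by rewrite lerD2r le_max lexx orbT.
have := main x y; have := main y x; rewrite (enorm_distC y x) ler_norml; lra.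
Qed.

Lemma cutoff_supp_in x : cutoff_supp x -> Omega x.
Proof.
move=> [dx _]; apply: (cdist_gt0_in Omega_proper); apply: lt_le_trans dx.
by rewrite mulr_gt0.
Qed.

Lemma cutoff_supp_compact : compact cutoff_supp.
Proof.
apply: bounded_closed_compact.
  exists (M + 2 * eps); split; first exact: num_real.
  by move=> N MN x [_ xM]; exact: le_trans xM (ltW MN).
have -> : cutoff_supp = (d @^-1` [set t | 2 * eps <= t]) `&`
    ((fun x : 'rV[R]_n => `|x|) @^-1` [set t | t <= M + 2 * eps]) by [].
apply: closedI; apply: closed_comp => [y _|].
- exact: continuous_cdist.
- exact: closed_ge.
- exact: norm_continuous.
- exact: closed_le.
Qed.

Let tame_cutoff : tame cutoff.
Proof.
have -> : cutoff = cutoff \_ setT by rewrite patch_setT.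
apply: (tame_patch (K := cutoff_supp)) => //.
- exact: openT.
- exact: cutoff_supp_compact.
- move=> x _; apply: enorm_lipschitz_continuous; exact: cutoff_lipschitz.
- by move=> x _ h; apply/eqP; apply: contra_notT h; exact: cutoff_neq0.
Qed.

Let box := [set x : 'rV[R]_n | forall i, `[- (M + 3 * eps), M + 3 * eps]%classic (x 0 i)].

Let tame_box : tame (\1_box : 'rV[R]_n -> R).
Proof.
split.
- apply: measurable_indic.
  by apply: (measurable_rV_forall (B := fun=> `[- (M + 3 * eps), M + 3 * eps]%classic)).
- by exists 1 => x; rewrite indicE; case: (x \in box); rewrite ?normr1 ?normr0.
- exists (M + 3 * eps) => x; rewrite indicE pnatr_eq0 eqb0 negbK => /set_mem h i.
  by have := h i; rewrite /= in_itv/= -ler_norml.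
Qed.

Let near_box x h : `|x| <= M + 2 * eps + h -> h <= eps -> box x.
Proof.
move=> xM he i /=; rewrite in_itv/= -ler_norml.
by apply: le_trans (coord_norm_le _ _) _; lra.
Qed.

Let tame_second_difference (g : 'rV[R]_n -> R) h i : small_step eps h -> tame g ->
  (forall x, g x != 0 -> 2 * eps <= d x) ->
  [/\ tame (fun x => g x * second_difference h i x),
      tame (fun x => (g (x + step h i) - g x) * (potential (x + step h i) - potential x)) &
      I (fun x => g x * second_difference h i x) =
      I (fun x => (g (x + step h i) - g x) * (potential (x + step h i) - potential x))].
Proof.
move=> sh tg gd; have [_ h0 heps hb] := sh.
have en : enorm (step h i) = h by rewrite enorm_step// ltW.
have inc x y : eps <= d x -> eps <= d y -> enorm (y - x) = h ->
    `|potential x - potential y| <= phi eps * h.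
  by move=> dx dy xy; rewrite distrC -xy; apply: potential_lipschitz; rewrite ?xy.
have t1 : tame (fun x => g x * (potential x - potential (x + step h i))).
  apply: (@tame_increment _ _ (phi eps * h)) => // x /gd dx.
  have de : eps + eps <= d x by lra.
  have [d1 d2] := cdist_step i sh de.
  by apply: inc => //; [have := eps0; lra|rewrite addrAC subrr add0r].
have t2 : tame (fun x => g x * (potential x - potential (x - step h i))).
  apply: (@tame_increment _ _ (phi eps * h)) => // x /gd dx.
  have de : eps + eps <= d x by lra.
  have [d1 d2] := cdist_step i sh de.
  by apply: inc => //; [have := eps0; lra|rewrite addrAC subrr add0r enormN].
have [t3 E] := summation_by_parts t1 t2.
split; [|exact: t3|exact: E].
suff -> : (fun x => g x * second_difference h i x) =
    (fun x => g x * (potential x - potential (x + step h i)) +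
              g x * (potential x - potential (x - step h i))) by exact: tameD.
by apply/funext => x; rewrite /second_difference; ring.
Qed.

(** Summation by parts replaces the second difference by the product of a first
    difference of the cutoff and one of the potential, each of size [h]. *)
Lemma cutoff_second_difference h i : small_step eps h ->
  I (fun x => cutoff x * second_difference h i x) <=
  h ^+ 2 * (phi eps * I (\1_box : 'rV[R]_n -> R)).
Proof.
move=> sh; have [_ h0 heps hb] := sh.
have cd x : cutoff x != 0 -> 2 * eps <= d x by move=> /cutoff_neq0[].
have [_ t ->] := tame_second_difference i sh tame_cutoff cd.
rewrite mulrA -tame_intZ//; apply: tame_int_le => //; first exact: tameZ.
move=> x.
have en : enorm (step h i) = h by rewrite enorm_step// ltW.
have phi0 : 0 <= phi eps by rewrite phi_ge0// eps0.
have rhs0 : 0 <= h ^+ 2 * phi eps * \1_box x.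
  by rewrite indicE mulr_ge0// mulr_ge0 ?sqr_ge0.
have [bx|nbx] := pselect (box x); last first.
  have c0 y : cutoff y != 0 -> enorm (x - y) <= h -> False.
    move=> /cutoff_neq0[_ yM] xy; apply: nbx; apply: near_box heps.
    rewrite -(subrK y x) (le_trans (ler_normD _ _))// addrC lerD//.
    exact: le_trans (norm_le_enorm _) xy.
  have -> : cutoff x = 0.
    apply/eqP/negPn/negP => /c0; apply.
    by rewrite subrr -(scale0r 0) enormZ normr0 mul0r ltW.
  have -> : cutoff (x + step h i) = 0; last by rewrite subrr mul0r.
  apply/eqP/negPn/negP => /c0; apply.
  by rewrite opprD addrA subrr sub0r enormN en.
have -> : \1_box x = 1 :> R by rewrite indicE mem_set.
rewrite mulr1.
have en' : enorm (x + step h i - x) = h by rewrite addrAC subrr add0r.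
suff dQ : eps + eps <= d x \/ eps + eps <= d (x + step h i) ->
    `|potential (x + step h i) - potential x| <= h * phi eps.
  have [cx|/cutoff_neq0[dx _]] := eqVneq (cutoff x) 0; last first.
    apply: le_trans (ler_norm _) _; rewrite normrM expr2 -mulrA ler_pM//.
      by rewrite (le_trans (cutoff_lipschitz _ _))// en'.
    by apply: dQ; left; lra.
  have [cx'|/cutoff_neq0[dx _]] := eqVneq (cutoff (x + step h i)) 0.
    by rewrite cx cx' subrr mul0r mulr_ge0 ?sqr_ge0.
  apply: le_trans (ler_norm _) _; rewrite normrM expr2 -mulrA ler_pM//.
    by rewrite (le_trans (cutoff_lipschitz _ _))// en'.
  by apply: dQ; right; lra.
have e0 := eps0.
have lip : eps <= d x -> eps <= d (x + step h i) ->
    `|potential (x + step h i) - potential x| <= h * phi eps.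
  move=> d1 d2; have := potential_lipschitz eps0 d1 d2; rewrite en' => /(_ hb).
  by rewrite mulrC.
case=> dx; have [d1 d2] := cdist_step i sh dx; first by apply: lip => //; lra.
by rewrite addrK in d2; apply: lip => //; lra.
Qed.

Let uw := (fun x => `|f x| * w (d x)) \_ Omega.
Let pg := (fun x => phi (d x) * enorm (gradient f x)) \_ Omega.

Let uwE x : uw x = u x * w (d x).
Proof. by rewrite /uw /u !patchE; case: ifP => // _; rewrite normr0 mul0r. Qed.

Let pg_ge0 x : 0 <= pg x.
Proof.
rewrite /pg patchE; case: ifPn => // /set_mem Ox.
by rewrite mulr_ge0 ?enorm_ge0// phi_ge0// cdist_in_profile.
Qed.

Let tame_uw : tame uw. Proof. exact: tame_weight. Qed.

Let tame_pg : tame pg.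
Proof.
apply: tame_gradient_weight => t tb; apply: is_derive_continuous.
by apply: derivableP; exact: phi_derivable.
Qed.

Let cutoff_second_difference_ge0 h i x : small_step eps h ->
  0 <= cutoff x * second_difference h i x.
Proof.
move=> sh; have [->|/cutoff_neq0[dx _]] := eqVneq (cutoff x) 0; first by rewrite mul0r.
by rewrite mulr_ge0 ?cutoff_ge0// (second_difference_ge0 _ sh)//; lra.
Qed.

Section step_estimate.
Variables (h eta L : R).
Hypotheses (sh : small_step eps h) (eta0 : 0 <= eta) (L0 : 0 <= L).
Hypothesis gradient_eta : forall x y i, cutoff_supp x -> `|x - y| <= h ->
  `|gradient f x 0 i - gradient f y 0 i| <= eta.
Hypothesis gradient_L : forall x i, cutoff_supp x -> `|gradient f x 0 i| + eta <= L.
Hypothesis w_eta : forall x t, K x -> `|t - d x| <= h -> w (d x) - eta <= w t.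

(** Outside this set the increments of [u] vanish; inside, the cutoff is at
    least [eps]. *)
Let core x := 3 * eps <= d x /\ `|x| <= M + eps.

Let core_supp x : core x -> cutoff_supp x.
Proof. by have e0 := eps0; case=> dx xM; split; lra. Qed.

Let increment_core x i : ~ core x -> u x = 0 /\ u (x + step h i) = 0.
Proof.
have e0 := eps0; have [_ h0 heps hb] := sh => ncx.
have en : enorm (step h i) = h by rewrite enorm_step// ltW.
split; apply/eqP/negPn/negP => /u_supp[_ Kx]; apply: ncx; have := Keps Kx; have := KM Kx.
  by split; lra.
move=> xM dx; split.
  have := cdist_lipschitz Omega_proper (x + step h i) x.
  by rewrite addrAC subrr add0r en; lra.
rewrite -[x](addrK (step h i)) (le_trans (ler_normB _ _))// lerD//.
by rewrite (le_trans (norm_le_enorm _))// en.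
Qed.

Let gain x : h ^+ 2 * (uw x - eta * u x) <=
  \sum_(i < n) u x * second_difference h i x.
Proof.
have e0 := eps0; rewrite -mulr_sumr uwE (mulrC eta) -mulrBr mulrCA.
have [->|/u_supp[Ox Kx]] := eqVneq (u x) 0; first by rewrite !mul0r.
rewrite ler_wpM2l ?normr_ge0// mulrC.
apply: (sum_second_difference sh); first by have := Keps Kx; lra.
by move=> t; exact: w_eta.
Qed.

(** The increment of [u] is at most [h * (`|gradient f x 0 i| + eta)] and that of
    the potential at most [h * phi * `|e 0 i|] plus a second difference; the sum
    of the main terms is estimated by Cauchy-Schwarz. *)
Let cost_core x : core x ->
  \sum_(i < n) (u (x + step h i) - u x) * (potential (x + step h i) - potential x)
  <= h ^+ 2 * (phi (d x) * (enorm (gradient f x) + n%:R * eta))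
     + h * L * \sum_(i < n) second_difference h i x.
Proof.
move=> cx; have [dx xM] := core_supp cx; have e0 := eps0.
have [_ h0 heps hb] := sh.
have ex : eps + eps <= d x by lra.
have Ox : Omega x by apply: cutoff_supp_in; exact: core_supp.
have [e se] := supergradient_ex Ox.
have p0 : 0 <= phi (d x) by rewrite phi_ge0// cdist_in_profile.
have e1 : enorm e = 1 by rewrite enormE se.1 sqrtr1.
have term i : (u (x + step h i) - u x) * (potential (x + step h i) - potential x) <=
    h ^+ 2 * (phi (d x) * (`|gradient f x 0 i| * `|e 0 i| + eta))
      + h * L * second_difference h i x.
  have [_ Ov _] := step_in i sh ex.
  have du : `|u (x + step h i) - u x| <= h * (`|gradient f x 0 i| + eta).
    apply: le_trans (ler_dist_dist _ _) _.
    rewrite !patchE !mem_set//; apply: (f_increment sh ex) => y xy.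
    by apply: gradient_eta => //; exact: core_supp.
  have S0 := second_difference_ge0 i sh ex.
  have dQ : `|potential (x + step h i) - potential x| <=
      h * (phi (d x) * `|e 0 i|) + second_difference h i x.
    have := potential_increment i sh ex se.
    have : h * (phi (d x) * e 0 i) <= h * (phi (d x) * `|e 0 i|).
      by rewrite ler_pM2l// ler_wpM2l// ler_norm.
    have : - (h * (phi (d x) * `|e 0 i|)) <= h * (phi (d x) * e 0 i).
      by rewrite -mulrN -mulrN ler_pM2l// ler_wpM2l// lerNl -normrN ler_norm.
    by rewrite ler_norml; lra.
  apply: le_trans (ler_norm _) _; rewrite normrM.
  apply: (@le_trans _ _ (h * (`|gradient f x 0 i| + eta) *
      (h * (phi (d x) * `|e 0 i|) + second_difference h i x))).
    by rewrite ler_pM.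
  have gL := gradient_L i (core_supp cx).
  have ei : `|e 0 i| <= 1 by rewrite -e1 coord_enorm_le.
  rewrite mulrDr; apply: lerD; last by rewrite ler_wpM2r// ler_pM2l.
  have -> : h * (`|gradient f x 0 i| + eta) * (h * (phi (d x) * `|e 0 i|)) =
      h ^+ 2 * (phi (d x) * ((`|gradient f x 0 i| + eta) * `|e 0 i|)) by ring.
  rewrite ler_wpM2l ?sqr_ge0// ler_wpM2l// mulrDl lerD2l.
  by rewrite -[leRHS]mulr1 ler_wpM2l.
apply: le_trans (ler_sum _ (fun i _ => term i)) _.
rewrite big_split/= -!mulr_sumr big_split/= sumr_const card_ord mulr_natl.
rewrite lerD2r ler_wpM2l ?sqr_ge0// ler_wpM2l// lerD2r.
by rewrite (le_trans (sum_abs_cauchy_schwarz _ _))// e1 mulr1.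
Qed.

Let cost x :
  \sum_(i < n) (u (x + step h i) - u x) * (potential (x + step h i) - potential x)
  <= h ^+ 2 * (pg x + n%:R * eta * phi eps / eps * cutoff x)
     + h * L / eps * \sum_(i < n) cutoff x * second_difference h i x.
Proof.
have e0 := eps0; have [_ h0 heps hb] := sh.
have p0 : 0 <= phi eps by rewrite phi_ge0// eps0.
have c0 : 0 <= n%:R * eta * phi eps / eps * cutoff x.
  by rewrite mulr_ge0 ?cutoff_ge0// divr_ge0 ?(ltW e0)// !mulr_ge0.
have [cx|ncx] := pselect (core x); last first.
  rewrite big1 => [|i _]; last by have [-> ->] := increment_core i ncx; rewrite subrr mul0r.
  rewrite addr_ge0//; first by rewrite mulr_ge0 ?sqr_ge0// addr_ge0.
  rewrite mulr_sumr; apply: sumr_ge0 => i _.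
  rewrite mulr_ge0 ?cutoff_second_difference_ge0// divr_ge0 ?(ltW e0)// mulr_ge0 ?(ltW h0)//.
have [dx xM] := cx.
have Ox : Omega x by apply: cutoff_supp_in; exact: core_supp.
have ce : 1 <= eps^-1 * cutoff x.
  by rewrite ler_pdivlMl// mulr1; exact: cutoff_ge.
have pd : phi (d x) <= phi eps.
  by apply: phi_nincr => //; [lra|have /andP[] := cdist_in_profile Ox].
apply: le_trans (cost_core cx) _; apply: lerD.
  rewrite ler_wpM2l ?sqr_ge0// mulrDr /pg patchE mem_set// lerD2l.
  have -> : n%:R * eta * phi eps / eps * cutoff x =
    (phi eps * (n%:R * eta)) * (eps^-1 * cutoff x) by ring.
  rewrite -[leLHS]mulr1 ler_pM// ?mulr_ge0//.
    by rewrite phi_ge0// cdist_in_profile.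
  by rewrite ler_wpM2r// mulr_ge0.
rewrite !mulr_sumr; apply: ler_sum => i _.
have -> : h * L / eps * (cutoff x * second_difference h i x) =
  (h * L * second_difference h i x) * (eps^-1 * cutoff x) by ring.
rewrite -[leLHS]mulr1 ler_wpM2l// mulr_ge0//.
  by rewrite mulr_ge0 ?(ltW h0).
by apply: (second_difference_ge0 _ sh); lra.
Qed.

(** Integrate [gain] and [cost], which summation by parts identifies; the last
    term carries one power of [h], since [cutoff_second_difference] gains two
    and the factor in front of the second differences in [cost] is [h] where
    the main terms have [h ^+ 2]. *)
Lemma energy_estimate : I uw <= I pg + eta * (I u + n%:R * phi eps / eps * I cutoff)
  + h * (L / eps * (n%:R * (phi eps * I (\1_box : 'rV[R]_n -> R)))).
Proof.
have e0 := eps0; have [_ h0 heps hb] := sh.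
have cd x : cutoff x != 0 -> 2 * eps <= d x by move=> /cutoff_neq0[].
have ud x : u x != 0 -> 2 * eps <= d x by move=> /u_supp[_ /Keps]; lra.
have tu i := tame_second_difference i sh tame_u ud.
have tc i := tame_second_difference i sh tame_cutoff cd.
have t1 : tame (fun x => uw x - eta * u x).
  by under eq_fun do rewrite -mulNr; apply: tameD => //; exact: tameZ.
have t2 : tame (fun x => pg x + n%:R * eta * phi eps / eps * cutoff x).
  by apply: tameD => //; exact: tameZ.
have tS : tame (fun x => \sum_(i < n) cutoff x * second_difference h i x).
  by apply: tame_sum => i; have [] := tc i.
have := tame_int_le (tameZ (h ^+ 2) t1)
  (tame_sum (index_enum 'I_n) (fun i => let: And3 t _ _ := tu i in t)) gain.
rewrite tame_intZ// tame_int_sum; last by move=> i; have [] := tu i.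
rewrite (eq_bigr (fun i => I (fun x => (u (x + step h i) - u x) *
  (potential (x + step h i) - potential x)))); last by move=> i _; have [] := tu i.
rewrite -tame_int_sum; last by move=> i; have [] := tu i.
move=> /le_trans H.
have := tame_int_le
  (tame_sum (index_enum 'I_n) (fun i => let: And3 _ t _ := tu i in t))
  (tameD (tameZ (h ^+ 2) t2) (tameZ (h * L / eps) tS)) cost.
move=> /H {H}; rewrite (tame_intD (tameZ (h ^+ 2) t2) (tameZ (h * L / eps) tS)).
rewrite (tame_intZ _ t2) (tame_intZ _ tS).
rewrite (tame_intD tame_pg (tameZ _ tame_cutoff)) (tame_intZ _ tame_cutoff).
rewrite tame_int_sum; last by move=> i; have [] := tc i.
have -> : I (fun x => uw x - eta * u x) = I uw - eta * I u.
  by rewrite tame_intB ?tame_intZ//; exact: tameZ.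
set S := \sum_(i < n) _ => H.
have SB : S <= n%:R * (h ^+ 2 * (phi eps * I (\1_box : 'rV[R]_n -> R))).
  apply: le_trans (ler_sum _ (fun i _ => cutoff_second_difference i sh)) _.
  by rewrite sumr_const card_ord mulr_natl.
have h2 : 0 < h ^+ 2 by rewrite exprn_gt0.
have cL : 0 <= h * L / eps by rewrite divr_ge0 ?(ltW e0)// mulr_ge0 ?(ltW h0).
have {}SB := ler_wpM2l cL SB.
rewrite -(ler_pM2l h2); move: H SB.
move: (I uw) (I pg) (I u) (I cutoff) (I _) (phi eps) (eps^-1) => a1 a2 a3 a4 a5 a6 a7.
by lra.
Qed.

End step_estimate.
End cutoff.

(** By uniform continuity of the gradient and of [w] on compact sets, the error
    [eta] in [energy_estimate] and the step [h] can both be made small. *)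
Lemma hardy_potential : 0 < b ->
  \int[lebesgue_rV]_x ((fun x => `|f x| * w (d x)) \_ Omega) x <=
  \int[lebesgue_rV]_x ((fun x => phi (d x) * enorm (gradient f x)) \_ Omega) x.
Proof.
move=> b0; have [eps [M [/andP[eps0 epsb] Keps KM]]] := support_margin b0.
have [_ cg cK KO] := fC1.
pose C := cutoff_supp eps M.
have cC : compact C by exact: cutoff_supp_compact.
have CO x : C x -> Omega x by exact: cutoff_supp_in.
have cgC x : C x -> {for x, continuous (gradient f)} by move=> /CO; exact: cg.
have [N [N0 CN]] : exists N, 0 <= N /\ forall x, C x -> `|gradient f x| <= N.
  have /compact_bounded[N [_ CN]] : compact (gradient f @` C).
    apply: continuous_compact => //; apply: continuous_in_subspaceT => x xC.
    by apply: cgC; exact: set_mem.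
  exists (`|N| + 1); split; first by rewrite addr_ge0.
  move=> x Cx; apply: (CN _ (le_lt_trans (ler_norm N) _)); last by exists x.
  by rewrite ltrDl.
have cI : compact `[4 * eps, D]%classic := @segment_compact _ _ _.
have wI t : `[4 * eps, D]%classic t -> {for t, continuous w}.
  rewrite /= in_itv/= => /andP[t1 t2]; apply: w_continuous.
  by have := Db => Db'; apply/andP; split; lra.
pose C1 := \int[lebesgue_rV]_x (`|(f \_ Omega) x|)
  + n%:R * phi eps / eps * \int[lebesgue_rV]_x cutoff eps M x.
pose C2 := (N + 1) / eps * (n%:R * (phi eps * \int[lebesgue_rV]_x
  (\1_[set x : 'rV[R]_n | forall i, `[- (M + 3 * eps), M + 3 * eps]%classic (x 0 i)] x))).
apply/ler_addgt0Pr => e e0.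
pose eta := Num.min 1 (e / (`|C1| + `|C2| + 1)).
have C0 : 0 < `|C1| + `|C2| + 1 by rewrite ltr_wpDl// addr_ge0.
have eta0 : 0 < eta by rewrite lt_min ltr01 divr_gt0.
have eta1 : eta <= 1 by rewrite ge_min lexx.
have etae : eta * (`|C1| + `|C2| + 1) <= e by rewrite -ler_pdivlMr// ge_min lexx orbT.
clearbody eta; have [r1 r10 H1] := compact_unif_continuous cC cgC eta0.
have [r2 r20 H2] := compact_unif_continuous cI wI eta0.
pose h := Num.min (Num.min eps ((b - D) / 2)) (Num.min (Num.min (r1 / 2) (r2 / 2)) eta).
have bD : 0 < b - D by rewrite subr_gt0.
have h0 : 0 < h by rewrite !lt_min eps0 eta0 !divr_gt0.
have [h1 h2] : h <= eps /\ h <= (b - D) / 2.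
  by split; rewrite !ge_min lexx ?orbT.
have [h3 h4] : h <= r1 / 2 /\ h <= r2 / 2.
  by split; rewrite !ge_min lexx ?orbT.
have h5 : h <= eta by rewrite !ge_min lexx ?orbT.
have sh : small_step eps h by split => //; lra.
have N10 : 0 <= N + 1 by lra.
have gE x y i : C x -> `|x - y| <= h -> `|gradient f x 0 i - gradient f y 0 i| <= eta.
  move=> Cx xy; have := H1 x y Cx; rewrite (le_lt_trans xy); last by lra.
  move=> /(_ isT) /ltW; apply: le_trans.
  have -> : gradient f x 0 i - gradient f y 0 i = (gradient f x - gradient f y) 0 i.
    by rewrite !mxE.
  exact: coord_norm_le.
have gL x i : C x -> `|gradient f x 0 i| + eta <= N + 1.
  by move=> /CN gN; rewrite lerD// (le_trans (coord_norm_le _ _)).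
have wE x t : K x -> `|t - d x| <= h -> w (d x) - eta <= w t.
  move=> Kx td; have dxI : `[4 * eps, D]%classic (d x).
    by rewrite /= in_itv/= Keps// cdist_le_D//; exact: KO.
  have := H2 (d x) t dxI; rewrite distrC (le_lt_trans td); last by lra.
  by move=> /(_ isT); rewrite ltr_norml; lra.
have := energy_estimate eps0 epsb Keps KM sh (ltW eta0) N10 gE gL wE.
rewrite -/C1 -/C2 => /le_trans; apply; rewrite -addrA lerD2l.
have : eta * C1 <= eta * `|C1| by rewrite ler_wpM2l ?(ltW eta0)// ler_norm.
have : h * C2 <= eta * `|C2|.
  by apply: (le_trans (ler_norm _)); rewrite normrM (gtr0_norm h0) ler_wpM2r.
by have := etae; lra.
Qed.

End compactly_supported.
End superharmonic.
End profile_calculus.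

(** * The weighted inequality and the limit to the inradius *)

Section hardy.
Context {R : realType} {n : nat}.
Variables (Omega : set 'rV[R]_n) (f : 'rV[R]_n -> R).
Hypotheses (oOmega : open Omega) (Omega_proper : ~` Omega !=set0).
Hypotheses (cOmega : @convex_set R 'rV[R]_n Omega) (fC1 : C1_compact_support Omega f).
Variable D : R.
Hypotheses (D0 : 0 < D) (cdist_le_D : forall x, Omega x -> cdist Omega x <= D).
Local Notation d := (cdist Omega).
Local Notation I g := (\int[lebesgue_rV]_x g x).

Definition weighted_mass (g : R -> R) := I ((fun x => `|f x| * g (d x)) \_ Omega).
Definition weighted_variation (g : R -> R) :=
  I ((fun x => g (d x) * enorm (gradient f x)) \_ Omega).

Definition continuous_gt0 (g : R -> R) := forall t : R, 0 < t -> {for t, continuous g}.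

Lemma tame_mass g : continuous_gt0 g -> tame ((fun x => `|f x| * g (d x)) \_ Omega).
Proof.
move=> cg; apply: (@tame_weight _ (D + 1) _ _ D) => //; first by rewrite ltrDl.
by move=> t /andP[t0 _]; exact: cg.
Qed.

Lemma tame_variation g : continuous_gt0 g ->
  tame ((fun x => g (d x) * enorm (gradient f x)) \_ Omega).
Proof.
move=> cg; apply: (@tame_gradient_weight _ (D + 1) _ _ D) => //; first by rewrite ltrDl.
by move=> t /andP[t0 _]; exact: cg.
Qed.

Lemma weighted_massD a c (g k : R -> R) : continuous_gt0 g -> continuous_gt0 k ->
  weighted_mass (fun t => a * g t + c * k t) = a * weighted_mass g + c * weighted_mass k.
Proof.
move=> /tame_mass tg /tame_mass tk.
rewrite /weighted_mass -!tame_intZ// -tame_intD; [|exact: tameZ..].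
congr Rintegral; apply/funext => x; rewrite !patchE; case: ifP => _; first by ring.
by rewrite !mulr0 addr0.
Qed.

Lemma weighted_variationD a c (g k : R -> R) : continuous_gt0 g -> continuous_gt0 k ->
  weighted_variation (fun t => a * g t + c * k t) =
  a * weighted_variation g + c * weighted_variation k.
Proof.
move=> /tame_variation tg /tame_variation tk.
rewrite /weighted_variation -!tame_intZ// -tame_intD; [|exact: tameZ..].
congr Rintegral; apply/funext => x; rewrite !patchE; case: ifP => _; first by ring.
by rewrite !mulr0 addr0.
Qed.

Lemma hardy_test_profile b (w W : R -> R) : D < b -> test_profile b w W ->
  (forall t, 0 < t < b -> 0 <= w t) -> continuous_gt0 w -> continuous_gt0 W ->
  weighted_mass w <= weighted_variation W.
Proof.
move=> Db [Psi [phi H]] w0 cw cW; have b0 := lt_trans D0 Db.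
have phi_derivable t : 0 < t < b -> derivable phi t 1 by move=> /H[].
apply: le_trans (@hardy_potential _ b w Psi phi _ phi_derivable _ _ w0
  _ _ D _ _ _ _ Db _ _ _ b0) _ => //.
- by move=> t /H[].
- by move=> t /H[].
- by move=> t /H[_ _ _ /andP[]].
- by move=> t /andP[t0 _]; exact: cw.
apply: tame_int_le.
- apply: (@tame_gradient_weight _ b _ _ D) => // t tb.
  apply: is_derive_continuous; apply: derivableP; exact: phi_derivable.
- exact: tame_variation.
- move=> x; rewrite !patchE; case: ifPn => // /set_mem Ox.
  rewrite ler_wpM2r ?enorm_ge0//.
  have /H[_ _ _ /andP[]// ] : 0 < d x < b.
  by rewrite (cdist_gt0 oOmega)//= (le_lt_trans (cdist_le_D Ox)).
Qed.

Lemma continuous_inv : continuous_gt0 (fun t => t^-1).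
Proof. by move=> t t0; apply: continuousV; [rewrite gt_eqF|exact: cvg_id]. Qed.

Lemma continuous_inv2 : continuous_gt0 (fun t => (t ^+ 2)^-1).
Proof.
move=> t t0; apply: continuousV; first by rewrite gt_eqF// exprn_gt0.
exact: exprn_continuous.
Qed.

Lemma continuous_powRV s : continuous_gt0 (fun t => (t `^ s)^-1).
Proof.
move=> t t0; apply: continuousV; first by rewrite gt_eqF// powR_gt0.
exact: is_derive_continuous (is_derive1_powR _ t0).
Qed.

(** The distance may take the value [D], which has to be an interior point of
    the interval of the profile; so [b > D] first, and then [b] tends to [D]. *)
Lemma hardy_lamb (m nu c alpha beta : R) : 0 < m -> 0 < nu -> nu * m <= 1 ->
  (forall b, D < b -> test_profile b (scaled_lamb_weight m nu c b)
     (fun t => alpha / t + beta / b)) ->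
  (1 - nu ^+ 2 * m ^+ 2) / 4 * weighted_mass (fun t => (t ^+ 2)^-1)
    + c ^+ 2 / D `^ m * weighted_mass (fun t => (t `^ (2 - m))^-1)
  <= alpha * weighted_variation (fun t => t^-1)
    + beta / D * weighted_variation (fun=> 1).
Proof.
move=> m0 nu0 num H.
have A0 : 0 <= (1 - nu ^+ 2 * m ^+ 2) / 4.
  by rewrite divr_ge0// -exprMn subr_ge0 expr_le1// mulr_ge0 ?ltW.
set A := (1 - _) / 4 in A0 *.
set P := weighted_mass _; set Q := weighted_mass _.
set X := weighted_variation _; set Y := weighted_variation _.
have Hb b : D < b -> A * P + c ^+ 2 / b `^ m * Q <= alpha * X + beta / b * Y.
  move=> Db; have b0 := lt_trans D0 Db.
  have c1 : continuous_gt0 (fun=> 1) by move=> t _; exact: cvg_cst.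
  rewrite -(weighted_massD A (c ^+ 2 / b `^ m) continuous_inv2 (@continuous_powRV (2 - m))).
  rewrite -(weighted_variationD alpha (beta / b) continuous_inv c1).
  apply: (@hardy_test_profile b) => //.
  - case: (H _ Db) => Psi [phi h]; exists Psi, phi => t tb.
    by have := h _ tb; rewrite mulr1.
  - move=> t /andP[t0 tb]; apply: addr_ge0.
      by apply: mulr_ge0 => //; rewrite invr_ge0 sqr_ge0.
    by rewrite mulr_ge0 ?invr_ge0 ?powR_ge0// mulr_ge0 ?sqr_ge0// invr_ge0 powR_ge0.
  - move=> t t0; apply: continuousD; apply: continuousM;
      [exact: cvg_cst|exact: continuous_inv2|exact: cvg_cst|exact: continuous_powRV].
  - move=> t t0; apply: continuousD; apply: continuousM;
      [exact: cvg_cst|exact: continuous_inv|exact: cvg_cst|exact: cvg_cst].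
pose F b := alpha * X + beta * Y * b^-1 - (A * P + c ^+ 2 * Q * (b `^ m)^-1).
have cF : F b @[b --> D^'+] --> F D.
  apply: cvg_at_right_filter; apply: cvgB; apply: cvgD; try exact: cvg_cst.
    by apply: cvgM; [exact: cvg_cst|exact: continuous_inv].
  by apply: cvgM; [exact: cvg_cst|exact: continuous_powRV].
have : 0 <= F D.
  apply: (cvgr_to_ge cF); near=> b; have : D < b by near: b; exact: nbhs_right_gt.
  by move=> /Hb; rewrite /F; lra.
by rewrite /F; lra.
Unshelve. all: by end_near. Qed.

Lemma integral_tame (g k : 'rV[R]_n -> R) : tame (g \_ Omega) ->
  (forall x, Omega x -> k x = g x) ->
  (\int[lebesgue_rV]_(x in Omega) (k x)%:E = (I (g \_ Omega))%:E)%E.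
Proof.
move=> tg kg.
rewrite [RHS]fineK; last by apply: integrable_fin_num => //; exact: tame_integrable.
rewrite [LHS]integral_mkcond; apply: eq_integral => x _.
by rewrite !patchE; case: ifPn => // /set_mem/kg ->.
Qed.

End hardy.

Section conclusion.
Context {R : realType} {n : nat}.
Variables (Omega : set 'rV[R]_n) (f : 'rV[R]_n -> R).
Hypotheses (oOmega : open Omega) (cOmega : @convex_set R 'rV[R]_n Omega).
Hypotheses (inr_fin : (inradius Omega < +oo)%E) (fC1 : C1_compact_support Omega f).
Local Notation delta := (fun x => fine (dist_boundary Omega x)).
Local Notation delta0 := (fine (inradius Omega)).

Lemma hardy_lamb_domain (m nu c alpha beta : R) : 0 < m -> 0 < nu -> nu * m <= 1 ->
  (forall b, 0 < b -> test_profile b (scaled_lamb_weight m nu c b)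
     (fun t => alpha / t + beta / b)) ->
  (((1 - nu ^+ 2 * m ^+ 2) / 4)%:E
     * \int[lebesgue_rV]_(x in Omega) (`|f x| / delta x ^+ 2)%:E
   + (c ^+ 2 / delta0 `^ m)%:E
     * \int[lebesgue_rV]_(x in Omega) (`|f x| / delta x `^ (2 - m))%:E
   <= alpha%:E
     * \int[lebesgue_rV]_(x in Omega) (enorm (gradient f x) / delta x)%:E
   + (beta / delta0)%:E
     * \int[lebesgue_rV]_(x in Omega) (enorm (gradient f x))%:E)%E.
Proof.
move=> m0 nu0 num H.
have [->|/set0P[x0 Ox0]] := eqVneq Omega set0.
  by rewrite !integral_set0 !mule0 !adde0.
have Op : ~` Omega !=set0 by apply: inradius_proper => //; exists x0.
have dD x : Omega x -> cdist Omega x <= delta0 by exact: cdist_le_inradius.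
have D0 : 0 < delta0 by apply: lt_le_trans (dD _ Ox0); exact: cdist_gt0.
have c1 : continuous_gt0 (fun=> 1 : R) by move=> t _; exact: cvg_cst.
rewrite (integral_tame (k := fun x => `|f x| / delta x ^+ 2)
    (tame_mass oOmega Op fC1 dD continuous_inv2)); last by move=> x Ox; rewrite dist_boundaryE.
rewrite (integral_tame (k := fun x => `|f x| / delta x `^ (2 - m))
    (tame_mass oOmega Op fC1 dD (@continuous_powRV _ (2 - m))));
  last by move=> x Ox; rewrite dist_boundaryE.
rewrite (integral_tame (k := fun x => enorm (gradient f x) / delta x)
    (tame_variation oOmega Op fC1 dD continuous_inv)); last first.
  by move=> x Ox; rewrite dist_boundaryE//= mulrC.
rewrite (integral_tame (k := fun x => enorm (gradient f x))
    (tame_variation oOmega Op fC1 dD c1)); last by move=> x _; rewrite mul1r.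
rewrite -!EFinM -!EFinD lee_fin.
apply: (hardy_lamb oOmega Op cOmega fC1 D0 dD) => // b Db.
by apply: H; exact: lt_trans Db.
Qed.

End conclusion.

Theorem theorem4 (R : realType) (n : nat) (Omega : set 'rV[R]_n)
    (m nu : R) (f : 'rV[R]_n -> R)
    (delta := fun x : 'rV[R]_n => fine (dist_boundary Omega x))
    (delta0 := fine (inradius Omega)) :
  open Omega ->
  @convex_set R 'rV[R]_n Omega ->
  (inradius Omega < +oo)%E ->
  0 < m ->
  0 < nu <= 1 / m ->
  C1_compact_support Omega f ->
  lebesgue_rV.-integrable Omega
    (fun x => (enorm (gradient f x) / delta x)%:E) ->
  (forall lambda c : R,
     0 <= lambda < (1 + nu * m) / 2 ->
     is_lamb_constant nu m lambda c ->
     (((1 - nu ^+ 2 * m ^+ 2) / 4)%:E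
        * \int[lebesgue_rV]_(x in Omega) (`|f x| / delta x ^+ 2)%:E
      + (c ^+ 2 / delta0 `^ m)%:E
        * \int[lebesgue_rV]_(x in Omega) (`|f x| / delta x `^ (2 - m))%:E
      <= ((1 + nu * m) / 2 - lambda ^+ 2)%:E
        * \int[lebesgue_rV]_(x in Omega) (enorm (gradient f x) / delta x)%:E
      + ((lambda ^+ 2 - lambda) / delta0)%:E
        * \int[lebesgue_rV]_(x in Omega) (enorm (gradient f x))%:E)%E)
  /\
  (forall lambda c : R,
     lambda <= 0 ->
     is_lamb_constant nu m lambda c ->
     (((1 - nu ^+ 2 * m ^+ 2) / 4)%:E
        * \int[lebesgue_rV]_(x in Omega) (`|f x| / delta x ^+ 2)%:E
      + (c ^+ 2 / delta0 `^ m)%:E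
        * \int[lebesgue_rV]_(x in Omega) (`|f x| / delta x `^ (2 - m))%:E
      <= ((1 + nu * m) / 2)%:E
        * \int[lebesgue_rV]_(x in Omega) (enorm (gradient f x) / delta x)%:E
      - (lambda / delta0)%:E
        * \int[lebesgue_rV]_(x in Omega) (enorm (gradient f x))%:E)%E).
Proof.
move=> oO cO iO m0 /andP[nu0 num] fC _.
have {}num : nu * m <= 1 by rewrite -ler_pdivlMr.
split => [lambda c l01 [root _]|lambda c _ [root _]].
  by apply: hardy_lamb_domain => // b b0; exact: lamb_test_profile_ge0.
rewrite -mulNe -EFinN -(mulNr lambda).
apply: hardy_lamb_domain => // b b0; rewrite mulNr.
have := lamb_test_profile_le0 m0 nu0 num root b0.
by apply: eq_test_profile => // t _; rewrite mulNr.
Qed.
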